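(* Let $G_{n,m}(p)$ be a random $m$-partite graph on $[n]$, $m=m(n)\ge 2$, with parts of sizes $n\nu_1(n),\dots,n\nu_m(n)$ and edge probability $p$, such that $$\lim_{n\to\infty}\max\{\nu_1(n),\dots,\nu_m(n)\}>0\quad\text{and}\quad\lim_{n\to\infty}\frac{\nu_i(n)}{\nu_j(n)}=1\ \text{ for all } i,j.$$ Then almost every random graph $G_{n,m}(p)$ satisfies $$\mathscr{E}(G_{n,m}(p))=n^{3/2}\left(\frac{8}{3\pi}\sqrt{\frac{m-1}{m}\,p(1-p)}+o(1)\right).$$
   Context: For a simple graph $G$ of order $n$ whose adjacency matrix has eigenvalues $\lambda_1,\dots,\lambda_n$, the energy is $\mathscr{E}(G)=\sum_{i=1}^n|\lambda_i|$. For each $n$, $[n]=\{1,\dots,n\}$ is partitioned into parts $V_1,\dots,V_m$, $m=m(n)\ge2$, with $|V_i|=n\nu_i(n)$; the random $m$-partite graph has vertex set $[n]$, and its edges are chosen independently with probability $p$ from the edges of the complete $m$-partite graph with parts $V_1,\dots,V_m$ (so there are no edges inside parts). ''Almost every'' random graph has a property if the probability that the random graph has the property tends to $1$ as $n\to\infty$. *)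

(* Defs.v *)
From HB Require Import structures.
From mathcomp Require Import all_boot all_order all_algebra.
From mathcomp Require Import complex.
From mathcomp Require Import all_classical all_reals all_analysis.

Set Implicit Arguments.
Unset Strict Implicit.
Unset Printing Implicit Defensive.

Import Order.TTheory GRing.Theory Num.Theory.
Import numFieldNormedType.Exports.

Local Open Scope ring_scope.

(* A simple graph on [n] is given by its edge set, a set of 2-element subsets
   of 'I_n. The type does not enforce that edges have two elements: the graphs
   considered below are all subgraphs of complete_multipartite, whose edges
   do, and adjacency ignores any other set. *)
Definition graph (n : nat) : Type := {set {set 'I_n}}.

Definition adjacency (F : nzRingType) (n : nat) (G : graph n) : 'M[F]_n :=
  \matrix_(u, v) ((u != v) && ([set u; v]%SET \in G))%:R.

(* The eigenvalues listed with algebraic multiplicity. *)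
Definition eigenvalues (F : closedFieldType) (n : nat) (A : 'M[F]_n) : seq F :=
  sval (closed_field_poly_normal (char_poly A)).

Lemma char_poly_eigenvalues (F : closedFieldType) (n : nat) (A : 'M[F]_n) :
  char_poly A = \prod_(z <- eigenvalues A) ('X - z%:P).
Proof.
rewrite /eigenvalues; case: closed_field_poly_normal => r /= {1}->.
by rewrite (monicP (char_poly_monic A)) scale1r.
Qed.

Lemma size_eigenvalues (F : closedFieldType) (n : nat) (A : 'M[F]_n) :
  size (eigenvalues A) = n.
Proof.
have := size_char_poly A.
by rewrite char_poly_eigenvalues size_prod_XsubC => -[].
Qed.

(* The eigenvalues are real, but are obtained as elements of R[i]; normc is
   the R-valued modulus. *)
Definition energy (R : realType) (n : nat) (G : graph n) : R :=
  \sum_(z <- eigenvalues (adjacency R[i] G)) ComplexField.Normc.normc z.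

(* V is an indexed partition of [n]. Empty parts are not excluded: for
   n < m they are unavoidable. *)
Definition vertex_partition (n m : nat) (V : 'I_m -> {set 'I_n}) : Prop :=
  (forall i j, i != j -> [disjoint V i & V j]) /\
  (\bigcup_i V i)%SET = [set: 'I_n]%SET.

(* The ratio nu_i, with |V_i| = n nu_i. *)
Definition part_ratio (R : realType) (n m : nat) (V : 'I_m -> {set 'I_n})
  (i : 'I_m) : R := #|V i|%:R / n%:R.

Definition complete_multipartite (n m : nat) (V : 'I_m -> {set 'I_n}) :
  graph n :=
  [set e : {set 'I_n} | (#|e| == 2%N) && [forall i, ~~ (e \subset V i)]]%SET.

(* The probability that a random subgraph of K, in which every edge of K is
   kept independently with probability p, satisfies Q. *)
Definition random_subgraph_prob (R : realType) (n : nat) (K : graph n) (p : R)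
  (Q : pred (graph n)) : R :=
  \sum_(G in powerset K | Q G) \prod_(e in K) (if e \in G then p else 1 - p).

Lemma random_subgraph_probT (R : realType) (n : nat) (K : graph n) (p : R) :
  random_subgraph_prob K p predT = 1.
Proof.
pose F e : R := if e \in K then p else 0.
pose F' e : R := if e \in K then 1 - p else 1.
have <- : \prod_e (F e + F' e) = 1.
  by rewrite big1 // => e _; rewrite /F /F'; case: ifP => _; rewrite ?subrKC ?add0r.
rewrite bigA_distr /random_subgraph_prob [RHS](bigID (fun G => G \in powerset K)) /=.
rewrite [X in _ = _ + X]big1 => [|G]; last first.
  rewrite powersetE => /fintype.subsetPn[e eG eK].
  by rewrite (bigD1 e) //= eG /F (negPf eK) mul0r.
rewrite addr0; apply: eq_big => [G|G]; first by rewrite andbT.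
rewrite andbT powersetE => /fintype.subsetP GK.
rewrite [RHS](bigID (mem K)) /= [X in _ = _ * X]big1 ?mulr1.
  by apply: eq_bigr => e eK; rewrite /F /F' eK.
move=> e eK; rewrite /F' (negPf eK); case: ifP => // /GK.
by rewrite (negPf eK).
Qed.

Definition almost_every_multipartite (R : realType) (m : nat -> nat)
  (V : forall n, 'I_(m n) -> {set 'I_n}) (p : R)
  (Q : forall n, pred (graph n)) : Prop :=
  (random_subgraph_prob (complete_multipartite (V n)) p (Q n)
    @[n --> \oo] --> (1 : R))%classic.

(* Main.v *)
(** Let [W] be the adjacency matrix of the random graph centered by [p] times
    that of the complete multipartite graph [K], and [H := n^(-1/2) W].  The
    diagonal entries of the resolvent [(H - i t)^-1] almost solve the
    self-consistent equation of the semicircle law: Schur's complement formula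
    expresses them by quadratic forms in one row of [H], which is independent of
    the rest of the matrix.  The equation is stable by contraction for [t >= 2],
    and its solution is then followed down the imaginary axis in small steps.
    Adding back [p K], a signed sum of rank-one matrices of total squared norm
    [2 n], perturbs the trace by only O(sqrt n).  Finally
    [|x| = (2 / pi) * \int_0^oo x^2 / (x^2 + t^2) dt] turns the control of the
    traces at finitely many [t] into that of the energy.  All the rows of [W] have
    asymptotically the same variance because the parts have asymptotically
    the same size; their number need not be bounded. *)
Require Import Defs.
From HB Require Import structures.
From mathcomp Require Import all_boot all_order all_algebra.
From mathcomp Require Import complex zify ring lra.
From mathcomp Require Import all_classical all_reals all_analysis.

Set Implicit Arguments.
Unset Strict Implicit.
Unset Printing Implicit Defensive.

Import Order.TTheory GRing.Theory Num.Theory.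
Import numFieldNormedType.Exports.

Local Open Scope classical_set_scope.
Local Open Scope ring_scope.

(** On the imaginary axis all that is needed of the semicircle law is the positive number
    [stieltjes sg t], a root of a real quadratic equation, and every resolvent is bounded by [t^-1].
    Only finitely many fixed [t > 0] matter: the integrand of Coulson's formula lies in [0, 1], so
    an interval of length [h] near 0 costs at most [h]. Constants may therefore blow up as [t] tends
    to 0, and bounds in mean followed by Markov's inequality suffice. The obstacle is that for small
    [t] the equation is no contraction on the whole range of the resolvent entries: its quadratic
    term is harmless only near the solution, so closeness has to be inherited from a slightly larger
    [t]. The matrix is centered because the self-consistent equation needs entries of mean zero; the
    mean [p K] is restored only at the level of traces. The constant [8 / (3 * pi)] is the factor
    [2 / pi] of Coulson's formula times [4 / 3], where [4 / 3 * sg] is the integral of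
    [1 - t * stieltjes sg t] over the half-line. *)

Local Notation Re := complex.Re.
Local Notation Im := complex.Im.

(** * Complex moduli and resolvents on the imaginary axis *)

Section Modulus.
Local Open Scope complex_scope.
Variable R : rcfType.
Implicit Types (z w : R[i]).

Local Notation normc := (@ComplexField.Normc.normc R).

Lemma normc_ge0 z : 0 <= normc z.
Proof. by case: z => a b; rewrite sqrtr_ge0. Qed.

Lemma sqr_normcE z : normc z ^+ 2 = Re z ^+ 2 + Im z ^+ 2.
Proof. by case: z => a b; rewrite /= sqr_sqrtr ?addr_ge0 ?sqr_ge0. Qed.

Lemma normcM z w : normc (z * w) = normc z * normc w.
Proof. exact: ComplexField.Normc.normcM. Qed.

Lemma normcD_le z w : normc (z + w) <= normc z + normc w.
Proof. exact: le_normcD. Qed.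

Lemma normcN z : normc (- z) = normc z.
Proof. exact: normcN. Qed.

Lemma normcB_le z w : normc (z - w) <= normc z + normc w.
Proof. by rewrite -(normcN w) normcD_le. Qed.

Lemma normc_real (x : R) : normc x%:C = `|x|.
Proof. by rewrite /= expr0n /= addr0 sqrtr_sqr. Qed.

Lemma normc_imag (x : R) : normc (0 +i* x) = `|x|.
Proof. by rewrite /= expr0n /= add0r sqrtr_sqr. Qed.

Lemma normc0 : normc 0 = 0.
Proof. exact: ComplexField.Normc.normc0. Qed.

Lemma normc_sum (I : Type) (r : seq I) (P : pred I) (F : I -> R[i]) :
  normc (\sum_(i <- r | P i) F i) <= \sum_(i <- r | P i) normc (F i).
Proof.
elim/big_rec2: _ => [|i y z _ h]; first by rewrite normc0.
by rewrite (le_trans (normcD_le _ _)) // lerD2l.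
Qed.

Lemma normc_Im z : `|Im z| <= normc z.
Proof.
rewrite -(ler_pXn2r (n := 2)) ?nnegrE ?normc_ge0 //.
by rewrite sqr_normcE real_normK ?num_real // lerDr sqr_ge0.
Qed.

Lemma normc_ReIm z : normc z <= `|Re z| + `|Im z|.
Proof.
rewrite -(ler_pXn2r (n := 2)) ?nnegrE ?normc_ge0 ?addr_ge0 //.
rewrite sqr_normcE sqrrD !real_normK ?num_real //.
by rewrite -subr_ge0 (_ : _ - _ = `|Re z| * `|Im z| *+ 2) ?mulrn_wge0 ?mulr_ge0 //; ring.
Qed.

Lemma Re_sum (I : Type) (r : seq I) (P : pred I) (F : I -> R[i]) :
  Re (\sum_(i <- r | P i) F i) = \sum_(i <- r | P i) Re (F i).
Proof. exact: (raddf_sum (@Re R : {additive R[i] -> R})). Qed.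

Lemma Im_sum (I : Type) (r : seq I) (P : pred I) (F : I -> R[i]) :
  Im (\sum_(i <- r | P i) F i) = \sum_(i <- r | P i) Im (F i).
Proof. exact: (raddf_sum (@Im R : {additive R[i] -> R})). Qed.

Lemma Re_realM (x : R) z : Re (x%:C * z) = x * Re z.
Proof. by case: z => a b /=; ring. Qed.

Lemma Im_realM (x : R) z : Im (x%:C * z) = x * Im z.
Proof. by case: z => a b /=; ring. Qed.

Definition sqnorm n (v : 'cV[R[i]]_n) : R := \sum_i normc (v i 0) ^+ 2.

Lemma sqnorm_ge0 n (v : 'cV[R[i]]_n) : 0 <= sqnorm v.
Proof. by apply: sumr_ge0 => i _; rewrite sqr_ge0. Qed.

Lemma sqnorm_entry n (v : 'cV[R[i]]_n) i : normc (v i 0) ^+ 2 <= sqnorm v.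
Proof. by rewrite /sqnorm (bigD1 i) //= lerDl sumr_ge0 // => j _; rewrite sqr_ge0. Qed.

Lemma sqnorm_eq0 n (v : 'cV[R[i]]_n) : sqnorm v = 0 -> v = 0.
Proof.
move=> v0; apply/matrixP => i j; rewrite ord1 mxE.
apply: (@ComplexField.Normc.eq0_normc R); apply/eqP.
by rewrite -sqrf_eq0 eq_le sqr_ge0 andbT -v0 sqnorm_entry.
Qed.

Lemma sqnorm_delta n (i : 'I_n) : sqnorm (delta_mx i 0) = 1.
Proof.
rewrite /sqnorm (bigD1 i) //= big1 => [|j ji]; rewrite mxE ?eqxx.
  by rewrite addr0 /= !(expr0n, expr1n) /= addr0 sqrtr1 expr1n.
by rewrite (negPf ji) normc0 expr0n.
Qed.

(* The products are handled by AM-GM, which replaces Cauchy-Schwarz throughout. *)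
Lemma normc_dot_le n (v w : 'I_n -> R[i]) :
  \sum_i normc (v i) * normc (w i) <=
  2^-1 * (\sum_i normc (v i) ^+ 2 + \sum_i normc (w i) ^+ 2).
Proof.
rewrite -big_split /= mulr_sumr; apply: ler_sum => i _.
by have := sqr_ge0 (normc (v i) - normc (w i)); nra.
Qed.

End Modulus.

Section Resolvent.
Local Open Scope complex_scope.
Variables (R : rcfType) (n : nat).
Implicit Types (H : 'M[R]_n) (t : R).

Local Notation normc := (@ComplexField.Normc.normc R).

Definition complexmx H : 'M[R[i]]_n := map_mx (real_complex R) H.

Definition shiftmx H t : 'M[R[i]]_n := complexmx H - (0 +i* t)%C%:M.

Definition resolvent H t : 'M[R[i]]_n := invmx (shiftmx H t).

(** For real symmetric [H] the squared norm of [(H - i t) v] is that of [H v] plus [t^2] times that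
    of [v], as symmetry kills the cross term. Invertibility and the resolvent bounds below all come
    from this. *)
Lemma sqnorm_shiftmx H t (v : 'cV[R[i]]_n) : H^T = H ->
  t ^+ 2 * sqnorm v <= sqnorm (shiftmx H t *m v).
Proof.
move=> Hsym; pose a k := Re (v k 0); pose b k := Im (v k 0).
pose P k := \sum_j H k j * a j; pose Q k := \sum_j H k j * b j.
have entry k : (shiftmx H t *m v) k 0 = ((P k + t * b k) +i* (Q k - t * a k)).
  rewrite mulmxBl mul_scalar_mx !mxE; apply/eqP; rewrite eq_complex /=.
  apply/andP; split; apply/eqP.
    rewrite raddfB /= Re_sum; congr (_ + _); last first.
      by rewrite /b; case: (v k 0) => x y /=; ring.
    by apply: eq_bigr => j _; rewrite !mxE Re_realM.
  rewrite raddfB /= Im_sum; congr (_ + _); last first.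
    by rewrite /a; case: (v k 0) => x y /=; ring.
  by apply: eq_bigr => j _; rewrite !mxE Im_realM.
have swap : \sum_k P k * b k = \sum_k Q k * a k.
  transitivity (\sum_k \sum_j H k j * a j * b k).
    by apply: eq_bigr => k _; rewrite mulr_suml.
  rewrite exchange_big /=; apply: eq_bigr => j _; rewrite mulr_suml.
  by apply: eq_bigr => k _; rewrite -[in LHS]Hsym mxE; ring.
rewrite /sqnorm mulr_sumr -subr_ge0 -sumrB.
under eq_bigr => k _ do rewrite entry !sqr_normcE /=.
rewrite [X in 0 <= X](_ : _ = \sum_k (P k ^+ 2 + Q k ^+ 2)
    + 2 * t * (\sum_k P k * b k - \sum_k Q k * a k)).
  rewrite swap subrr mulr0 addr0; apply: sumr_ge0 => k _.
  by rewrite addr_ge0 ?sqr_ge0.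
rewrite -sumrB mulr_sumr -big_split /=; apply: eq_bigr => k _.
by rewrite /a /b; ring.
Qed.

Lemma shiftmx_unit H t : 0 < t -> H^T = H -> shiftmx H t \in unitmx.
Proof.
move=> t0 Hsym; rewrite -unitmx_tr -row_free_unit -kermx_eq0.
apply/eqP/row_matrixP => i; rewrite row0.
have : row i (kermx (shiftmx H t)^T) *m (shiftmx H t)^T = 0.
  by rewrite -row_mul mulmx_ker row0.
set u := row i _ => /(congr1 trmx); rewrite trmx_mul trmxK trmx0 => u0.
have := sqnorm_shiftmx t u^T Hsym; rewrite u0.
have -> : sqnorm (0 : 'cV[R[i]]_n) = 0.
  by apply: big1 => k _; rewrite mxE normc0 expr0n.
rewrite pmulr_rle0 ?exprn_gt0 // => le0.
by rewrite -[u]trmxK (@sqnorm_eq0 _ _ u^T) ?trmx0 //; apply/eqP; rewrite eq_le le0 sqnorm_ge0.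
Qed.

Section Facts.
Variables (H : 'M[R]_n) (t : R).
Hypotheses (t0 : 0 < t) (Hsym : H^T = H).
Local Notation G := (resolvent H t).

Lemma shiftmxK : shiftmx H t *m G = 1%:M.
Proof. by rewrite mulmxV ?shiftmx_unit. Qed.

Lemma resolventK : G *m shiftmx H t = 1%:M.
Proof. by rewrite mulVmx ?shiftmx_unit. Qed.

Lemma sqnorm_resolvent v : sqnorm (G *m v) <= t ^- 2 * sqnorm v.
Proof.
rewrite mulrC ler_pdivlMr ?exprn_gt0 // mulrC.
by rewrite (le_trans (sqnorm_shiftmx t _ Hsym)) // mulmxA shiftmxK mul1mx.
Qed.

Lemma resolvent_sym : G^T = G.
Proof.
have Hc : (complexmx H)^T = complexmx H.
  by apply/matrixP => i j; rewrite !mxE -[in LHS]Hsym mxE.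
by rewrite /resolvent trmx_inv /shiftmx linearB /= tr_scalar_mx Hc.
Qed.

Lemma resolvent_symE i j : G i j = G j i.
Proof. by rewrite -[in LHS]resolvent_sym mxE. Qed.

Lemma resolvent_col_le j : \sum_i normc (G i j) ^+ 2 <= t ^- 2.
Proof.
have := sqnorm_resolvent (delta_mx j 0); rewrite sqnorm_delta mulr1.
by rewrite /sqnorm -colE; under eq_bigr => i _ do rewrite mxE.
Qed.

Lemma resolvent_row_le i : \sum_j normc (G i j) ^+ 2 <= t ^- 2.
Proof.
by rewrite (le_trans _ (resolvent_col_le i)) //; apply: ler_sum => j _; rewrite resolvent_symE.
Qed.

Lemma resolvent_entry_le i j : normc (G i j) <= t^-1.
Proof.
rewrite -(ler_pXn2r (n := 2)) ?nnegrE ?normc_ge0 ?invr_ge0 ?(ltW t0) // exprVn.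
rewrite (le_trans _ (resolvent_col_le j)) // (bigD1 i) //= lerDl.
by rewrite sumr_ge0 // => k _; rewrite sqr_ge0.
Qed.

Lemma resolvent_diag i : (complexmx H *m G) i i = 1 + (0 +i* t)%C * G i i.
Proof.
have := congr1 (fun M : 'M[R[i]]_n => M i i) shiftmxK.
rewrite mulmxBl mul_scalar_mx !mxE eqxx mulr1n => /eqP.
by rewrite subr_eq => /eqP.
Qed.

End Facts.

(** By the resolvent identity [G(t) - G(t') = i (t - t') G(t) G(t')], a diagonal entry of the
    difference pairs a row of one resolvent with a column of the other. *)
Lemma resolvent_lip H t t' i : 0 < t -> t <= t' -> H^T = H ->
  normc (resolvent H t i i - resolvent H t' i i) <= (t' - t) * t ^- 2.
Proof.
move=> t0 tt' Hsym; have t'0 := lt_le_trans t0 tt'.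
have E : resolvent H t - resolvent H t' =
    (0 +i* (t - t'))%C *: (resolvent H t *m resolvent H t').
  have D : shiftmx H t' - shiftmx H t = (0 +i* (t - t'))%:M.
    rewrite /shiftmx opprB addrC addrA subrK; apply/matrixP => k l; rewrite !mxE.
    case: (k == l); rewrite ?mulr0n ?subrr // !mulr1n.
    by apply/eqP; rewrite eq_complex /= subrr !eqxx.
  rewrite -[resolvent H t in LHS]mulmx1 -(shiftmxK t'0 Hsym).
  rewrite -[X in _ - X]mul1mx -(resolventK t0 Hsym) !mulmxA -mulmxBl.
  by rewrite -mulmxBr D mul_mx_scalar -scalemxAl.
have -> : resolvent H t i i - resolvent H t' i i =
    (resolvent H t - resolvent H t') i i by rewrite !mxE.
rewrite E !mxE normcM normc_imag ler0_norm ?subr_le0 // opprB.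
rewrite ler_wpM2l ?subr_ge0 // (le_trans (normc_sum _ _ _)) //.
under eq_bigr => k _ do rewrite normcM.
rewrite (le_trans (normc_dot_le _ _)) //.
have := resolvent_row_le t0 Hsym i; have := resolvent_col_le t'0 Hsym i.
have : t' ^- 2 <= t ^- 2 by rewrite lef_pV2 ?posrE ?exprn_gt0 // ler_pXn2r // nnegrE ltW.
lra.
Qed.

(** By cyclicity the trace is the scalar [v^T G' G v], so that only the norm of [v] enters, not the
    dimension. *)
Lemma trace_resolvent_rank1 H H' t (v : 'cV[R[i]]_n) : 0 < t -> H^T = H -> H'^T = H' ->
  normc (\tr (resolvent H t *m (v *m v^T) *m resolvent H' t)) <= t ^- 2 * sqnorm v.
Proof.
move=> t0 Hsym Hsym'.
rewrite mxtrace_mulC !mulmxA mxtrace_mulC /mxtrace big_ord_recl big_ord0 addr0.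
rewrite !mxE (le_trans (normc_sum _ _ _)) //.
set u := _ *m v.
rewrite (eq_bigr (fun k => normc (u k 0) * normc (v k 0))); last first.
  by move=> k _; rewrite normcM mxE mulrC.
have u_le : sqnorm u <= t ^- 2 * (t ^- 2 * sqnorm v).
  rewrite /u -mulmxA (le_trans (sqnorm_resolvent t0 Hsym' _)) //.
  by rewrite ler_wpM2l ?sqnorm_resolvent // invr_ge0 exprn_ge0 // ltW.
have t2 : 0 < t ^+ 2 by rewrite exprn_gt0.
have t2N : t ^+ 2 != 0 by rewrite gt_eqF.
move: u_le; rewrite -(ler_pM2l t2) mulVKf // -(ler_pM2l t2) mulVKf // => u_le.
rewrite -(ler_pM2l t2) mulVKf // mulr_sumr.
(* AM-GM is applied to [t^2 |u k|] and [|v k|]: both families have a sum of squares of at most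
   [sqnorm v]. *)
apply: (@le_trans _ _ (2^-1 * (t ^+ 2 * (t ^+ 2 * sqnorm u) + sqnorm v))); last by lra.
rewrite /sqnorm !mulr_sumr -big_split /= mulr_sumr; apply: ler_sum => k _.
have := sqr_ge0 (t ^+ 2 * normc (u k 0) - normc (v k 0)).
set x := normc (u k 0); set y := normc (v k 0); nra.
Qed.

End Resolvent.

(** * Schur's complement formula *)

Section SchurComplement.
Local Open Scope complex_scope.
Variables (R : rcfType) (n : nat).
Implicit Types (H : 'M[R]_n) (t : R).

Local Notation normc := (@ComplexField.Normc.normc R).

(** Row and column are zeroed rather than deleted, so that the dimension stays [n]; the vertex
    merely decouples, with diagonal resolvent entry [0 +i* t^-1]. *)
Definition isolate H (i : 'I_n) : 'M[R]_n :=
  \matrix_(k, l) (if (k == i) || (l == i) then 0 else H k l).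

Lemma isolate_sym H i : H^T = H -> (isolate H i)^T = isolate H i.
Proof. by move=> Hsym; apply/matrixP => k l; rewrite !mxE orbC -[in LHS]Hsym mxE. Qed.

Definition quad_form H t i : R[i] :=
  \sum_k \sum_l (H k i * H l i)%:C * resolvent (isolate H i) t k l.

Variables (H : 'M[R]_n) (t : R) (i : 'I_n).
Hypotheses (t0 : 0 < t) (Hsym : H^T = H) (Hii : H i i = 0).
Local Notation G := (resolvent H t).
Local Notation G' := (resolvent (isolate H i) t).
Let h : 'cV[R[i]]_n := col i (complexmx H).
Let d : 'cV[R[i]]_n := delta_mx i 0.

Let Hsplit : complexmx H = complexmx (isolate H i) + h *m d^T + d *m h^T.
Proof.
have HC k l : H k l = H l k by rewrite -[in LHS]Hsym mxE.
apply/matrixP => k l; rewrite !mxE !big_ord_recl !big_ord0 !addr0 !mxE !eqxx !andbT.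
have [->|ki] := eqVneq k i; have [->|li] := eqVneq l i => /=.
- by rewrite Hii !mul0r mulr0 !addr0.
- by rewrite mulr0 mul1r !add0r HC.
- by rewrite mulr1 mul0r addr0 add0r.
- by rewrite mulr0 mul0r !addr0.
Qed.

Let isolate_delta : G' *m d = (0 +i* t^-1) *: d.
Proof.
have G'K := resolventK t0 (isolate_sym i Hsym).
have : shiftmx (isolate H i) t *m d = (0 +i* (- t)) *: d.
  apply/matrixP => k l; rewrite mulmxBl mul_scalar_mx !mxE (bigD1 i) //=.
  rewrite big1 => [|m mi]; rewrite !mxE ?(negPf mi) ?mulr0 //.
  rewrite eqxx orbT (_ : 0%:C = 0) // mul0r addr0 sub0r -mulNr; congr (_ * _).
  by apply/eqP; rewrite eq_complex /= oppr0 !eqxx.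
move/(congr1 (mulmx G')); rewrite mulmxA G'K mul1mx -scalemxAr => {2}->.
rewrite scalerA.
suff -> : (0 +i* t^-1) * (0 +i* (- t)) = 1 :> R[i] by rewrite scale1r.
apply/eqP; rewrite eq_complex /=; apply/andP; split; apply/eqP; last by ring.
by field; rewrite gt_eqF.
Qed.

(** [shiftmx H t] is the shift of [isolate H i] plus [h d^T + d h^T]. Multiplying
    [shiftmx H t *m G = 1] by [G'] on the left gives this rank-two form of Schur's formula. *)
Let schur : G + G' *m h *m row i G + (0 +i* t^-1) *: (d *m (h^T *m G)) = G'.
Proof.
have E : shiftmx H t = shiftmx (isolate H i) t + h *m d^T + d *m h^T.
  by rewrite /shiftmx Hsplit -!addrA; congr (_ + _); rewrite [RHS]addrC addrA.
have := shiftmxK t0 Hsym; rewrite E 2!mulmxDl => /(congr1 (mulmx G')).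
rewrite mulmx1 !mulmxDr (mulmxA G' (shiftmx _ _)) resolventK ?isolate_sym //.
rewrite mul1mx -!mulmxA (mulmxA G' d) isolate_delta -scalemxAl.
by rewrite trmx_delta -rowE.
Qed.

Lemma schur_diag_entry k : k != i ->
  G k k + (G' *m h) k 0 * G i k = G' k k.
Proof.
move=> ki; have := congr1 (fun M : 'M[R[i]]_n => M k k) schur.
rewrite !mxE !big_ord_recl !big_ord0 /= addr0 => <-.
rewrite [d k _]mxE (negPf ki) /= mul0r !addr0 mulr0 addr0.
by rewrite [row i G _ _]mxE !mxE.
Qed.

Lemma quad_formE : (h^T *m G' *m h) 0 0 = quad_form H t i.
Proof.
rewrite /quad_form mxE exchange_big /=; apply: eq_bigr => l _.
rewrite mxE mulr_suml; apply: eq_bigr => k _; rewrite !mxE.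
by rewrite rmorphM /= mulrAC.
Qed.

(** The identity [schur] is tested against [h] on the left and [d] on the right; the terms
    containing [h^T d] vanish because [H i i = 0]. *)
Lemma schur_diag : (complexmx H *m G) i i = - (quad_form H t i * G i i).
Proof.
have hd : h^T *m d = 0.
  by rewrite /d -colE; apply/matrixP => k l; rewrite !mxE Hii.
have hG'd : h^T *m G' *m d = 0 by rewrite -mulmxA isolate_delta -scalemxAr hd scaler0.
have HG : (complexmx H *m G) i i = (h^T *m G *m d) 0 0.
  rewrite /d -colE !mxE; apply: eq_bigr => k _; rewrite !mxE.
  by congr (_%:C * _); rewrite -[in LHS]Hsym mxE.
have := congr1 (fun M => (h^T *m M *m d) 0 0) schur.
rewrite hG'd [RHS]mxE !mulmxDr !mulmxDl -scalemxAr -scalemxAl.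
rewrite [h^T *m (d *m _)]mulmxA hd mul0mx mul0mx scaler0 addr0.
rewrite [in X in X -> _]mxE -HG => /eqP; rewrite addr_eq0 => /eqP ->; congr (- _).
rewrite -quad_formE !mulmxA -mulmxA mxE big_ord_recl big_ord0 addr0.
by rewrite /d -colE !mxE.
Qed.

Variable S : 'M[R]_n.
Hypotheses (Sii : S i i = 0) (S_ge0 : forall k, 0 <= S i k)
  (S_le : forall k, S i k <= n%:R^-1) (H_le1 : \sum_k H k i ^+ 2 <= 1).

(** For [k != i], [G' k k - G k k] is an entry of [G' h] times an entry of row [i] of [G], two
    vectors of squared norm at most [t^-2]. The index [i] itself has weight [S i i = 0]. *)
Lemma self_energy_stability :
  normc (\sum_k (S i k)%:C * G k k - \sum_k (S i k)%:C * G' k k) <= n%:R^-1 * t ^- 2.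
Proof.
rewrite -sumrB (le_trans (normc_sum _ _ _)) //.
apply: (@le_trans _ _ (n%:R^-1 * \sum_k normc ((G' *m h) k 0) * normc (G i k))).
  rewrite mulr_sumr; apply: ler_sum => k _; rewrite -mulrBr normcM normc_real ger0_norm //.
  have [->|ki] := eqVneq k i.
    by rewrite Sii mul0r !mulr_ge0 ?invr_ge0 ?normc_ge0 ?ler0n.
  rewrite -(schur_diag_entry ki) opprD addrA subrr sub0r normcN normcM.
  by rewrite ler_wpM2r // mulr_ge0 ?normc_ge0.
rewrite ler_wpM2l ?invr_ge0 ?ler0n // (le_trans (normc_dot_le _ _)) //.
have := resolvent_row_le t0 Hsym i.
have : \sum_k normc ((G' *m h) k 0) ^+ 2 <= t ^- 2.
  apply: (le_trans (sqnorm_resolvent t0 (isolate_sym i Hsym) h)).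
  rewrite ler_piMr ?invr_ge0 ?exprn_ge0 ?(ltW t0) // (le_trans _ H_le1) //.
  by apply: ler_sum => k _; rewrite !mxE normc_real real_normK ?num_real.
lra.
Qed.

(** When [S] holds the variances of the entries, the sum over [G'] is the mean of the quadratic form
    given the rest of the matrix; the defect is thus reduced to a fluctuation. *)
Lemma self_consistency_error :
  normc ((complexmx H *m G) i i + (\sum_k (S i k)%:C * G k k) * G i i) <=
  t^-1 * (normc (quad_form H t i - \sum_k (S i k)%:C * G' k k) + n%:R^-1 * t ^- 2).
Proof.
rewrite schur_diag addrC -mulrBl normcM mulrC ler_pM ?normc_ge0 //.
  exact: resolvent_entry_le.
set q := quad_form _ _ _; set s := \sum_k _; set s' := \sum_k _.
rewrite (_ : s - q = (s - s') - (q - s')); last by ring.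
rewrite (le_trans (normcB_le _ _)) // addrC lerD2l.
exact: self_energy_stability.
Qed.

End SchurComplement.

(** * Stability of the self-consistent equation *)

Section SemicircleStieltjes.
Variable R : rcfType.
Implicit Types sg t : R.

(* [i * stieltjes sg t] is the value at [i t] of the Stieltjes transform of the
   semicircle law of variance [sg ^+ 2]. *)
Definition stieltjes sg t : R := 2 / (t + Num.sqrt (t ^+ 2 + 4 * sg ^+ 2)).

Lemma stieltjes_gt0 sg t : 0 < t -> 0 < stieltjes sg t.
Proof. by move=> t0; rewrite divr_gt0 // ltr_wpDr ?sqrtr_ge0. Qed.

Lemma stieltjes_eq sg t : 0 < t ->
  stieltjes sg t * t + sg ^+ 2 * stieltjes sg t ^+ 2 = 1.
Proof.
move=> t0; rewrite /stieltjes; set r := Num.sqrt _.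
have r0 : 0 <= r by rewrite sqrtr_ge0.
have r2 : r ^+ 2 = t ^+ 2 + 4 * sg ^+ 2.
  by rewrite sqr_sqrtr // addr_ge0 ?sqr_ge0 // mulr_ge0 ?sqr_ge0.
have -> : sg ^+ 2 = (r ^+ 2 - t ^+ 2) / 4 by rewrite r2; field.
by field; rewrite gt_eqF // ltr_wpDr.
Qed.

Lemma stieltjes_le sg t : 0 < t -> stieltjes sg t <= t^-1.
Proof.
move=> t0; rewrite -[leRHS]mul1r ler_pdivlMr // -[leRHS](stieltjes_eq sg t0).
by rewrite lerDl mulr_ge0 ?sqr_ge0.
Qed.

(** Each equation is solved as [t = s^-1 - sg^2 s]. Arbitrary roots are allowed in place of
    [stieltjes], so that the root [sg^-1] at [t = 0] is covered too. *)
Lemma stieltjes_increment sg t t' s s' : 0 < s -> 0 < s' ->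
  s * t + sg ^+ 2 * s ^+ 2 = 1 -> s' * t' + sg ^+ 2 * s' ^+ 2 = 1 ->
  t' - t = (s - s') * ((s * s')^-1 + sg ^+ 2).
Proof.
move=> s0 s'0 E E'.
have -> : t = (1 - sg ^+ 2 * s ^+ 2) / s by rewrite -E; field; rewrite gt_eqF.
have -> : t' = (1 - sg ^+ 2 * s' ^+ 2) / s' by rewrite -E'; field; rewrite gt_eqF.
by field; rewrite !gt_eqF.
Qed.

Lemma stieltjes_nincr sg t t' : 0 < t -> t <= t' -> stieltjes sg t' <= stieltjes sg t.
Proof.
move=> t0 tt'; have t'0 := lt_le_trans t0 tt'.
rewrite -subr_ge0 -(pmulr_lge0 _ (x := (stieltjes sg t * stieltjes sg t')^-1 + sg ^+ 2)).
  have := stieltjes_increment (stieltjes_gt0 sg t0) (stieltjes_gt0 sg t'0).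
  by move=> /(_ _ _ _ (stieltjes_eq sg t0) (stieltjes_eq sg t'0)) <-; rewrite subr_ge0.
by rewrite ltr_wpDr ?sqr_ge0 // invr_gt0 mulr_gt0 ?stieltjes_gt0.
Qed.

Lemma stieltjes_lip sg t t' : 0 < t -> t <= t' ->
  stieltjes sg t - stieltjes sg t' <= (t' - t) * t ^- 2.
Proof.
move=> t0 tt'; have t'0 := lt_le_trans t0 tt'.
have s0 := stieltjes_gt0 sg t0; have s'0 := stieltjes_gt0 sg t'0.
rewrite (stieltjes_increment s0 s'0 (stieltjes_eq sg t0) (stieltjes_eq sg t'0)).
have := stieltjes_nincr sg t0 tt'; have := stieltjes_le sg t0.
move: s0 s'0; set s := stieltjes sg t; set s' := stieltjes sg t' => s0 s'0 st s's.
rewrite -mulrA ler_peMr ?subr_ge0 //.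
rewrite ler_pdivlMr ?exprn_gt0 // mul1r.
apply: (@le_trans _ _ (s * s')^-1); last by rewrite lerDl sqr_ge0.
have ss'0 := mulr_gt0 s0 s'0; have t20 : 0 < (t ^+ 2)^-1 by rewrite invr_gt0 exprn_gt0.
rewrite -[t ^+ 2]invrK lef_pV2 //.
rewrite -exprVn expr2; apply: ler_pM => //; rewrite ?(ltW s0) ?(ltW s'0) //.
exact: le_trans s's st.
Qed.

End SemicircleStieltjes.

Section Stability.
Local Open Scope complex_scope.
Variables (R : rcfType) (n : nat).
Local Notation normc := (@ComplexField.Normc.normc R).

(** The moduli of the single deviations are averaged: the equation is nonlinear in each diagonal
    entry, so closeness of the trace alone would not propagate. *)
Definition resolvent_deviation sg (H : 'M[R]_n) t : R :=
  n%:R^-1 * \sum_i normc (resolvent H t i i - (0 +i* stieltjes sg t)).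

(** As [(H G) i i = 1 + z * G i i] with [z = 0 +i* t], each summand is the error in [1 + z * G i i +
    (\sum_k S i k * G k k) * G i i = 0]. *)
Definition self_consistency_defect (H S : 'M[R]_n) t : R :=
  n%:R^-1 * \sum_i normc ((complexmx H *m resolvent H t) i i +
    (\sum_k (S i k)%:C * resolvent H t k k) * resolvent H t i i).

Variables (H S : 'M[R]_n) (sg eta : R).
Hypotheses (Hsym : H^T = H) (Ssym : S^T = S) (S_ge0 : forall i k, 0 <= S i k)
  (S_le : forall i k, S i k <= n%:R^-1) (sg_le : sg ^+ 2 <= 1 / 4)
  (S_row : forall i, `|\sum_k S i k - sg ^+ 2| <= eta) (n_gt0 : (0 < n)%N).

Let eta_ge0 : 0 <= eta.
Proof. exact: le_trans (normr_ge0 _) (S_row (Ordinal n_gt0)). Qed.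

Let x t i := normc (resolvent H t i i - (0 +i* stieltjes sg t)).
Let e t i := normc ((complexmx H *m resolvent H t) i i +
    (\sum_k (S i k)%:C * resolvent H t k k) * resolvent H t i i).
Let X := resolvent_deviation sg H.
Let E := self_consistency_defect H S.

Let n0 : 0 < n%:R :> R. Proof. by rewrite ltr0n. Qed.
Let x_ge0 t i : 0 <= x t i. Proof. exact: normc_ge0. Qed.

Let nX t : \sum_i x t i = n%:R * X t.
Proof. by rewrite /X /resolvent_deviation mulVKf ?(gt_eqF n0). Qed.

Let X_ge0 t : 0 <= X t.
Proof.
by rewrite /X /resolvent_deviation mulr_ge0 ?invr_ge0 ?ler0n ?sumr_ge0 // => i _; exact: x_ge0.
Qed.

Let E_ge0 t : 0 <= E t.
Proof.
rewrite /E /self_consistency_defect mulr_ge0 ?invr_ge0 ?ler0n ?sumr_ge0 // => i _.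
exact: normc_ge0.
Qed.

Let y_le t i : \sum_k S i k * x t k <= X t.
Proof. by rewrite /X /resolvent_deviation mulr_sumr; apply: ler_sum => k _; rewrite ler_wpM2r. Qed.

Let x_le t i : 0 < t -> x t i <= 2 * t^-1.
Proof.
move=> t0; rewrite (le_trans (normcB_le _ _)) // normc_imag ger0_norm ?(ltW (stieltjes_gt0 _ t0)) //.
have := resolvent_entry_le t0 Hsym i i; have := stieltjes_le sg t0; lra.
Qed.

(** The limit [g = 0 +i* s] satisfies [g (z + sg^2 g) = -1]. Comparison with the equation of [G i i]
    writes [G i i - g] as [- g] times the defect plus [g * G i i] times the averaged deviations and
    the error of the row sum. *)
Let deviation_entry t i : 0 < t ->
  x t i <= stieltjes sg t * e t i +
    stieltjes sg t * normc (resolvent H t i i) *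
      (\sum_k S i k * x t k + eta * stieltjes sg t).
Proof.
move=> t0; set s := stieltjes sg t; set g : R[i] := 0 +i* s.
have s0 : 0 < s := stieltjes_gt0 sg t0.
set Gi : R[i] := resolvent H t i i.
set Sh : R[i] := \sum_k (S i k)%:C * resolvent H t k k.
set er : R[i] := (complexmx H *m resolvent H t) i i + Sh * Gi.
have gE : g * ((0 +i* t) + (sg ^+ 2)%:C * g) = -1.
  apply/eqP; rewrite eq_complex /=; apply/andP; split; apply/eqP; last by ring.
  by rewrite -(stieltjes_eq sg t0) -/s; ring.
pose a1 : R[i] := - g * er; pose a2 : R[i] := \sum_k (S i k)%:C * (resolvent H t k k - g).
pose a3 : R[i] := (\sum_k S i k - sg ^+ 2)%:C * g; pose a5 : R[i] := a2 + a3.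
pose a4 : R[i] := g * Gi * a5.
have key : Gi - g = a1 + a4.
  rewrite /a1 /a4 /a5 /a2 /a3.
  have -> : \sum_k (S i k)%:C * (resolvent H t k k - g) = Sh - (\sum_k S i k)%:C * g.
    rewrite rmorph_sum mulr_suml -sumrB; apply: eq_bigr => k _; exact: mulrBr.
  rewrite /er (resolvent_diag t0 Hsym) -/Gi rmorphB /=.
  set z := 0 +i* t in gE *; set r := (\sum_k S i k)%:C; set v := (sg ^+ 2)%:C in gE *.
  apply/eqP; rewrite -subr_eq0; apply/eqP.
  transitivity (Gi * (1 + g * (z + v * g))); first by ring.
  by rewrite gE subrr mulr0.
rewrite /x -/g -/Gi key (le_trans (normcD_le _ _)) //.
have ng : normc g = s by rewrite normc_imag gtr0_norm.
have sG : 0 <= s * normc Gi := mulr_ge0 (ltW s0) (normc_ge0 _).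
rewrite /a1 /a4 !normcM normcN ng lerD // ler_wpM2l //.
rewrite (le_trans (normcD_le _ _)) // lerD //.
  rewrite (le_trans (normc_sum _ _ _)) //; apply: ler_sum => k _.
  by rewrite normcM normc_real ger0_norm.
by rewrite /a3 normcM normc_real ng ler_wpM2r ?(ltW s0).
Qed.

Let sum_y t : \sum_i \sum_k S i k * x t k <= (sg ^+ 2 + eta) * (n%:R * X t).
Proof.
rewrite exchange_big /= -nX mulr_sumr; apply: ler_sum => k _.
rewrite -mulr_suml ler_wpM2r //.
rewrite (eq_bigr (fun i => S k i)) => [|i _]; last by rewrite -[in LHS]Ssym mxE.
by have := S_row k; rewrite ler_norml => /andP[_]; lra.
Qed.

Let X_lip t t' : 0 < t -> t <= t' -> X t <= X t' + 2 * (t' - t) * t ^- 2.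
Proof.
move=> t0 tt'; rewrite -(ler_pM2l n0) mulrDr -!nX.
have -> : n%:R * (2 * (t' - t) * t ^- 2) = \sum_(i < n) 2 * (t' - t) * t ^- 2.
  by rewrite sumr_const card_ord mulr_natl.
rewrite -big_split /=; apply: ler_sum => i _; rewrite /x.
set a := resolvent H t i i; set b := resolvent H t' i i.
set s := stieltjes sg t; set s' := stieltjes sg t'.
rewrite (_ : a - (0 +i* s) = (b - (0 +i* s')) + ((a - b) - (0 +i* (s - s')))); last first.
  by rewrite (_ : 0 +i* (s - s') = (0 +i* s) - (0 +i* s')); [ring | rewrite /GRing.add /= subrr].
rewrite (le_trans (normcD_le _ _)) // lerD2l (le_trans (normcB_le _ _)) //.
rewrite normc_imag ger0_norm ?subr_ge0 ?stieltjes_nincr //.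
have := resolvent_lip i t0 tt' Hsym; have := stieltjes_lip sg t0 tt'.
rewrite -/a -/b -/s -/s'; lra.
Qed.

(** Here [s] and the resolvent entries are at most [1 / 2], so the linear coefficient is at most
    [1 / 4]: the equation contracts without any prior closeness. *)
Lemma deviation_start t : 2 <= t -> X t <= E t + eta.
Proof.
move=> t2; have t0 : 0 < t by lra.
have s0 := stieltjes_gt0 sg t0; have sV := stieltjes_le sg t0.
have tV : t^-1 <= 1 / 2 by rewrite div1r lef_pV2 ?posrE //; lra.
suff : X t <= 2^-1 * E t + (1 / 4) * (X t + eta * (1 / 2)).
  by have := eta_ge0; have := E_ge0 t; lra.
rewrite -(ler_pM2l n0) -nX mulrDr.
have -> : n%:R * (2^-1 * E t) = \sum_i 2^-1 * e t i.
  by rewrite -mulr_sumr mulrCA /E /self_consistency_defect mulVKf ?(gt_eqF n0).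
have -> : n%:R * (1 / 4 * (X t + eta * (1 / 2))) = \sum_(i < n) 1 / 4 * (X t + eta * (1 / 2)).
  by rewrite sumr_const card_ord mulr_natl.
rewrite -big_split /=; apply: ler_sum => i _; apply: (le_trans (deviation_entry i t0)).
move: (stieltjes sg t) s0 sV => s s0 sV.
have G_le := resolvent_entry_le t0 Hsym i i.
have G_ge := normc_ge0 (resolvent H t i i).
have e0 : 0 <= e t i := normc_ge0 _.
have y0 : 0 <= \sum_k S i k * x t k by apply: sumr_ge0 => k _; exact: mulr_ge0.
apply: lerD; first by rewrite ler_wpM2r //; lra.
apply: ler_pM.
- by rewrite mulr_ge0 // ltW.
- by rewrite addr_ge0 // mulr_ge0 // ltW.
- by rewrite (_ : 1 / 4 = 1 / 2 * (1 / 2)); [apply: ler_pM => //; lra | field].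
- by rewrite lerD ?y_le // ler_wpM2l //; lra.
Qed.

(* The coefficient [s^2 sg^2 = 1 - t s] of the linear term is below [1] on the
   imaginary axis; the quadratic term is absorbed by the proximity of [X t] to
   [X t'], which is assumed to be already controlled. *)
Lemma deviation_step t t' : 0 < t -> t <= t' -> t' - t <= t ^+ 3 / 4 ->
  X t <= 2 * t^-1 * E t + 6 * t ^- 3 * eta + 4 * t ^- 2 * X t'.
Proof.
move=> t0 tt' tau.
have s0 := stieltjes_gt0 sg t0; have sV := stieltjes_le sg t0.
have sE := stieltjes_eq sg t0.
have G_le i : normc (resolvent H t i i) <= stieltjes sg t + x t i.
  rewrite -[X in normc X](subrK (0 +i* stieltjes sg t)) addrC.
  rewrite (le_trans (normcD_le _ _)) // lerD2r.
  by rewrite normc_imag gtr0_norm.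
have entry i := @deviation_entry t i t0.
move: (stieltjes sg t) s0 sV sE G_le entry => s s0 sV sE G_le entry.
have u0 : 0 < t^-1 by rewrite invr_gt0.
have Xlt : X t <= 2 * t^-1.
  rewrite -(ler_pM2l n0) -nX.
  have -> : n%:R * (2 * t^-1) = \sum_(i < n) 2 * t^-1 by rewrite sumr_const card_ord mulr_natl.
  by apply: ler_sum => i _; apply: x_le.
(* One factor [X t] is replaced by [X t' + t / 2]: the Lipschitz bound turns a step of at most
   [t^3 / 4] into [t / 2]. *)
have XX : X t * X t <= 2 * t^-1 * X t' + t / 2 * X t.
  have lip := X_lip t0 tt'.
  have : 2 * (t' - t) * t ^- 2 <= t / 2.
    rewrite ler_pdivrMr ?exprn_gt0 //.
    by apply: le_trans (_ : 2 * (t ^+ 3 / 4) <= _); [lra | rewrite le_eqVlt; apply/orP; left; apply/eqP; field].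
  have := X_ge0 t; have := X_ge0 t' => X'0 X0 D.
  have : X t * X t <= X t * (X t' + t / 2) by rewrite ler_wpM2l //; lra.
  have : X t * X t' <= 2 * t^-1 * X t' by rewrite ler_wpM2r.
  by rewrite mulrDr; lra.
have main : X t <= s * E t + s ^+ 2 * (sg ^+ 2 + eta) * X t + s * (X t * X t) + s ^+ 2 * t^-1 * eta.
  rewrite -(ler_pM2l n0) -nX.
  apply: (@le_trans _ _ (\sum_i (s * e t i + s ^+ 2 * (\sum_k S i k * x t k)
     + s * X t * x t i + s ^+ 2 * t^-1 * eta))).
    apply: ler_sum => i _; rewrite (le_trans (entry i)) // -!addrA lerD2l.
    have G_le' := resolvent_entry_le t0 Hsym i i.
    have y0 : 0 <= \sum_k S i k * x t k by apply: sumr_ge0 => k _; exact: mulr_ge0.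
    have yX := y_le t i; have xi := x_ge0 t i.
    move: (G_le i) G_le' y0 yX; set y := \sum_k _; set G := normc _ => Gs G_le' y0 yX.
    rewrite -mulrA; have G0 : 0 <= G := normc_ge0 _.
    rewrite [leRHS](_ : _ = s * (s * y + X t * x t i + t^-1 * (eta * s))); last by ring.
    rewrite ler_pM2l // mulrDr lerD //; last by rewrite ler_wpM2r // mulr_ge0 // ltW.
    apply: (@le_trans _ _ ((s + x t i) * y)); first by rewrite ler_wpM2r.
    by rewrite mulrDl lerD2l mulrC ler_wpM2r.
  rewrite !big_split /= -!mulr_sumr sumr_const card_ord.
  have -> : \sum_i e t i = n%:R * E t.
    by rewrite /E /self_consistency_defect mulVKf ?(gt_eqF n0).
  rewrite [leRHS](_ : _ = s * (n%:R * E t) + s ^+ 2 * ((sg ^+ 2 + eta) * (n%:R * X t)) +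
    s * X t * (\sum_i x t i) + s ^+ 2 * t^-1 * (eta *+ n)); last by rewrite nX; ring.
  by rewrite lerD2r lerD2r lerD2l ler_wpM2l ?sqr_ge0 // sum_y.
(* The linear coefficient is [1 - s t] and the quadratic term adds back [s t / 2], so [s t / 2]
   times [X t] survives on the left. *)
have st0 : 0 < s * t / 2 by rewrite divr_gt0 ?mulr_gt0.
rewrite -(ler_pM2l st0).
have -> : s * t / 2 * (2 * t^-1 * E t + 6 * t ^- 3 * eta + 4 * t ^- 2 * X t') =
   s * E t + 3 * s * t ^- 2 * eta + 2 * s * t^-1 * X t' by field; rewrite gt_eqF.
have b1 : s * (X t * X t) <= s * (2 * t^-1 * X t' + t / 2 * X t) by rewrite ler_pM2l.
have b2 : s ^+ 2 * eta * X t <= 2 * s * t ^- 2 * eta.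
  rewrite [leRHS](_ : _ = (s * t^-1) * eta * (2 * t^-1)); last by field; rewrite gt_eqF.
  apply: ler_pM => //; first by rewrite mulr_ge0 ?sqr_ge0.
  by rewrite ler_wpM2r // expr2 ler_wpM2l // ltW.
have b3 : s ^+ 2 * t^-1 * eta <= s * t ^- 2 * eta.
  rewrite ler_wpM2r // [leRHS](_ : _ = (s * t^-1) * t^-1); last by field; rewrite gt_eqF.
  by rewrite ler_wpM2r ?(ltW u0) // expr2 ler_wpM2l // ltW.
have sE' : s ^+ 2 * sg ^+ 2 * X t = X t - s * t * X t by rewrite -[X in X - _]mul1r -sE; ring.
move: main; rewrite mulrDr mulrDl sE' => main.
lra.
Qed.

End Stability.

(** * Random subgraphs *)

Section Mean.
Variables (R : realType) (n : nat) (K : graph n) (p : R).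
Implicit Types (G : graph n) (f g : graph n -> R) (e : {set 'I_n}).

Definition subgraph_weight G : R := \prod_(e in K) (if e \in G then p else 1 - p).

Definition mean f : R := \sum_(G in powerset K) f G * subgraph_weight G.

Hypothesis p01 : 0 <= p <= 1.

Let p_ge0 : 0 <= p. Proof. by case/andP: p01. Qed.
Let p_le1 : p <= 1. Proof. by case/andP: p01. Qed.

Lemma subgraph_weight_ge0 G : 0 <= subgraph_weight G.
Proof.
by apply: prodr_ge0 => e _; case: ifP => _; have := p_ge0; have := p_le1; lra.
Qed.

Lemma mean_le f g : (forall G, G \subset K -> f G <= g G) ->
  mean f <= mean g.
Proof.
move=> fg; apply: ler_sum => G; rewrite powersetE => /fg.
by apply: ler_wpM2r; exact: subgraph_weight_ge0.
Qed.

Lemma eq_mean f g : (forall G, G \subset K -> f G = g G) ->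
  mean f = mean g.
Proof. by move=> fg; apply: eq_bigr => G; rewrite powersetE => /fg ->. Qed.

Lemma mean_sum (I : Type) (r : seq I) (P : pred I) (F : I -> graph n -> R) :
  mean (fun G => \sum_(i <- r | P i) F i G) = \sum_(i <- r | P i) mean (F i).
Proof.
rewrite /mean exchange_big /=; apply: eq_bigr => G _.
by rewrite mulr_suml.
Qed.

Lemma meanD f g : mean (fun G => f G + g G) = mean f + mean g.
Proof. by rewrite /mean -big_split; apply: eq_bigr => G _; rewrite mulrDl. Qed.

Lemma meanZ c f : mean (fun G => c * f G) = c * mean f.
Proof. by rewrite /mean mulr_sumr; apply: eq_bigr => G _; rewrite mulrA. Qed.

Lemma mean_cst c : mean (fun=> c) = c.
Proof.
rewrite /mean -mulr_sumr (_ : \sum_(G in _) _ = 1) ?mulr1 //.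
rewrite -[RHS](random_subgraph_probT K p); apply: eq_bigl => G.
by rewrite andbT.
Qed.

Lemma mean_ge0 f : (forall G, G \subset K -> 0 <= f G) -> 0 <= mean f.
Proof. by move=> f0; rewrite -[0](mean_cst 0) mean_le. Qed.

Lemma markov_inequality f delta : (forall G, G \subset K -> 0 <= f G) -> 0 < delta ->
  1 - delta^-1 * mean f <= random_subgraph_prob K p (fun G => f G <= delta).
Proof.
move=> f0 d0; rewrite lerBlDr -[X in X <= _](random_subgraph_probT K p).
have -> : random_subgraph_prob K p predT =
    mean (fun G => (f G <= delta)%R%:R + (~~ (f G <= delta)%R)%:R).
  rewrite -[LHS]mul1r /random_subgraph_prob mulr_sumr; apply: eq_big => G.
    by rewrite andbT.
  by case: (f G <= delta); rewrite ?addr0 ?add0r.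
rewrite meanD lerD //; last first.
  rewrite -meanZ; apply: mean_le => G GK.
  have [fd|fd] := leP (f G) delta; first by rewrite mulr0n mulr_ge0 ?invr_ge0 ?f0 // ltW.
  by rewrite mulr1n mulrC ler_pdivlMr // mul1r ltW.
rewrite /mean /random_subgraph_prob big_mkcondr /=; apply: ler_sum => G _.
by case: ifP => _; rewrite ?mul1r ?mul0r.
Qed.

(** That a function does not depend on the edge [e] is encoded as its invariance under
    [toggle e]. *)
Definition toggle e G : graph n := if e \in G then (G :\ e)%SET else (e |: G)%SET.

Lemma toggleK e : involutive (toggle e).
Proof.
move=> G; rewrite /toggle; have [eG|eG] := boolP (e \in G).
  by rewrite !inE eqxx /= finset.setD1K.
by rewrite !inE eqxx /= finset.setU1K.
Qed.

Lemma mem_toggle e e' G : e' != e -> (e' \in toggle e G) = (e' \in G).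
Proof. by move=> ee'; rewrite /toggle; case: ifP => _; rewrite !inE (negPf ee'). Qed.

Lemma toggle_mem e G : (e \in toggle e G) = (e \notin G).
Proof. by rewrite /toggle; case: ifP => eG; rewrite !inE eqxx. Qed.

Lemma toggle_subset e G : e \in K -> (toggle e G \subset K) = (G \subset K).
Proof.
move=> eK; apply/fintype.subsetP/fintype.subsetP => GK e'.
  by have [->//|ee'] := eqVneq e' e; rewrite -(mem_toggle _ ee') => /GK.
by have [->//|ee'] := eqVneq e' e; rewrite mem_toggle // => /GK.
Qed.

(* Toggling [e] is an involution of the subgraphs which changes the sign of
   each summand. *)
Lemma mean_centered_edge e f : e \in K ->
  (forall G, f (toggle e G) = f G) -> mean (fun G => ((e \in G)%:R - p) * f G) = 0.
Proof.
move=> eK fe; set Ef := mean _.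
suff : Ef = - Ef by move=> ?; lra.
rewrite {1}/Ef /mean (reindex_inj (inv_inj (toggleK e))) /= -sumrN.
apply: eq_big => G; first by rewrite !powersetE toggle_subset.
move=> _; rewrite fe toggle_mem /subgraph_weight !(bigD1 e eK) /= toggle_mem.
rewrite (eq_bigr (fun e' => if e' \in G then p else 1 - p)); last first.
  by move=> e' /andP[_ ee']; rewrite mem_toggle.
by case: (e \in G) => /=; ring.
Qed.

Lemma mean_sqr_orthogonal (I : finType) (P : pred I) (Y : I -> graph n -> R) :
  (forall a b, P a -> P b -> a != b -> mean (fun G => Y a G * Y b G) = 0) ->
  mean (fun G => (\sum_(a | P a) Y a G) ^+ 2) =
  \sum_(a | P a) mean (fun G => Y a G ^+ 2).
Proof.
move=> orth.
transitivity (mean (fun G => \sum_(a | P a) \sum_(b | P b) Y a G * Y b G)).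
  apply: eq_mean => G _; rewrite expr2 mulr_suml.
  by apply: eq_bigr => a _; rewrite mulr_sumr.
rewrite mean_sum; apply: eq_bigr => a Pa; rewrite mean_sum (bigD1 a) //=.
by rewrite big1 ?addr0 // => b /andP[Pb ba]; rewrite orth // eq_sym.
Qed.

End Mean.

(** * Quadratic forms in a row of the centered adjacency matrix *)

Section CenteredAdjacency.
Variables (R : realType) (n : nat) (K : graph n) (p : R).
Hypothesis p01 : 0 <= p <= 1.

Let p_ge0 : 0 <= p. Proof. by case/andP: p01. Qed.
Let p_le1 : p <= 1. Proof. by case/andP: p01. Qed.
Implicit Types (G : graph n) (u v i k l : 'I_n).

Definition centered_adjacency G : 'M[R]_n := adjacency R G - p *: adjacency R K.

Local Notation W := centered_adjacency.
Local Notation E := (mean K p).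

Lemma adjacency_sym G : (adjacency R G)^T = adjacency R G.
Proof. by apply/matrixP => u v; rewrite !mxE eq_sym finset.setUC. Qed.

Lemma centered_adjacency_sym G : (W G)^T = W G.
Proof. by rewrite /W linearB linearZ /= !adjacency_sym. Qed.

Lemma centered_adjacency_diag G u : W G u u = 0.
Proof. by rewrite !mxE eqxx /= mulr0 subrr. Qed.

Lemma centered_adjacency_edge G u v : u != v -> [set u; v]%SET \in K ->
  W G u v = ([set u; v]%SET \in G)%:R - p.
Proof. by move=> uv uvK; rewrite !mxE uv uvK /= mulr1. Qed.

Lemma centered_adjacency_nonedge G u v : G \subset K -> [set u; v]%SET \notin K ->
  W G u v = 0.
Proof.
move=> GK uvK; rewrite !mxE (negPf uvK) andbF mulr0 subr0.
by rewrite (contraNF (fintype.subsetP GK _) uvK) andbF.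
Qed.

Lemma centered_adjacency_cases G u v : G \subset K ->
  [\/ W G u v = 0 /\ adjacency R K u v = 0,
      W G u v = 1 - p /\ adjacency R K u v = 1 |
      W G u v = - p /\ adjacency R K u v = 1].
Proof.
move=> GK; have [->|uv] := eqVneq u v.
  by constructor 1; rewrite centered_adjacency_diag mxE eqxx.
have [uvK|uvK] := boolP ([set u; v]%SET \in K); last first.
  by constructor 1; rewrite centered_adjacency_nonedge // mxE (negPf uvK) andbF.
rewrite centered_adjacency_edge // mxE uv uvK.
by case: (_ \in G); [constructor 2 | constructor 3; rewrite sub0r].
Qed.

(** A centered Bernoulli variable takes two values, so its square is affine in it. The diagonal part
    of a centered quadratic form thereby becomes linear in the row. *)
Lemma sqr_centered_adjacency G u v : G \subset K ->
  W G u v ^+ 2 = p * (1 - p) * adjacency R K u v + (1 - 2 * p) * W G u v.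
Proof. by move=> GK; case: (centered_adjacency_cases u v GK) => -[-> ->]; ring. Qed.

Lemma sqr_centered_adjacency_le1 G u v : G \subset K -> W G u v ^+ 2 <= 1.
Proof.
have := p_ge0; have := p_le1.
by move=> ? ? GK; case: (centered_adjacency_cases u v GK) => -[-> _]; nra.
Qed.

Lemma centered_adjacency_toggle (e : {set 'I_n}) G u v : [set u; v]%SET != e ->
  W (toggle e G) u v = W G u v.
Proof. by move=> uve; rewrite !mxE mem_toggle. Qed.

Lemma centered_adjacency_toggle_row i k l G : k != l ->
  W (toggle [set l; i]%SET G) k i = W G k i.
Proof.
move=> kl; have [->|ki] := eqVneq k i; first by rewrite !centered_adjacency_diag.
apply: centered_adjacency_toggle; apply/eqP => /setP /(_ k).
by rewrite !inE eqxx (negPf kl) (negPf ki).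
Qed.

Lemma mean_centered_adjacency i k (f : graph n -> R) :
  (forall G, f (toggle [set k; i]%SET G) = f G) -> E (fun G => W G k i * f G) = 0.
Proof.
move=> fe; have [->|ki] := eqVneq k i.
  rewrite -[RHS](mean_cst K p 0); apply: eq_mean => G _.
  by rewrite centered_adjacency_diag mul0r.
have [kiK|kiK] := boolP ([set k; i]%SET \in K); last first.
  rewrite -[RHS](mean_cst K p 0); apply: eq_mean => G GK.
  by rewrite centered_adjacency_nonedge // mul0r.
rewrite -[RHS](mean_centered_edge p kiK fe); apply: eq_mean => G _.
by rewrite centered_adjacency_edge.
Qed.

Section QuadraticForm.
Variables (i : 'I_n) (M : graph n -> 'M[R]_n).
Hypotheses (M_sym : forall G, (M G)^T = M G)
  (M_toggle : forall k G, M (toggle [set k; i]%SET G) = M G).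

(** The subtracted sum is the mean of the double sum with [M] frozen, which is legitimate since
    [M_toggle] makes [M] independent of the edges at [i]. *)
Definition centered_quad_form G : R :=
  \sum_k \sum_l W G k i * W G l i * M G k l
  - \sum_k p * (1 - p) * adjacency R K i k * M G k k.

Let Y (a : 'I_n * 'I_n) G := W G a.1 i * W G a.2 i * M G a.1 a.2.

Let quad_formE G : G \subset K -> centered_quad_form G =
  2 * (\sum_(a : 'I_n * 'I_n | (a.1 < a.2)%N) Y a G)
  + (1 - 2 * p) * \sum_k W G k i * M G k k.
Proof.
move=> GK; rewrite /centered_quad_form pair_bigA /=.
have diag : \sum_(a : 'I_n * 'I_n | a.1 == a.2) Y a G = \sum_k W G k i * W G k i * M G k k.
  rewrite (reindex (fun k => (k, k))) /=.
    by rewrite (eq_bigl xpredT) // => k; rewrite eqxx.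
  by exists fst => [k _ //|[k l]]; rewrite inE /= => /eqP ->.
have upper : \sum_(a : 'I_n * 'I_n | (a.1 != a.2) && (a.1 < a.2)%N) Y a G =
    \sum_(a : 'I_n * 'I_n | (a.1 < a.2)%N) Y a G.
  by apply: eq_bigl => -[k l] /=; rewrite -val_eqE /=; case: ltngtP.
have lower : \sum_(a : 'I_n * 'I_n | (a.1 != a.2) && ~~ (a.1 < a.2)%N) Y a G =
    \sum_(a : 'I_n * 'I_n | (a.1 < a.2)%N) Y a G.
  have swapK : involutive (fun a : 'I_n * 'I_n => (a.2, a.1)) by case.
  rewrite (reindex_inj (inv_inj swapK)) /=; apply: eq_big => [[k l]|[k l] _] /=.
    by rewrite -val_eqE /=; case: ltngtP.
  have MC : M G l k = M G k l by rewrite -[in LHS]M_sym mxE.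
  by rewrite /Y /= MC; ring.
rewrite (bigID (fun a : 'I_n * 'I_n => a.1 == a.2)) /= diag.
rewrite (bigID (fun a : 'I_n * 'I_n => (a.1 < a.2)%N)) /= upper lower.
rewrite addrAC -sumrB (_ : \sum_(k < n) (_ - _) = (1 - 2 * p) * \sum_k W G k i * M G k k).
  by ring.
rewrite mulr_sumr; apply: eq_bigr => k _; rewrite -expr2 sqr_centered_adjacency //.
have KC : adjacency R K i k = adjacency R K k i by rewrite -[in LHS]adjacency_sym mxE.
by rewrite KC; ring.
Qed.

(** Of two distinct increasing pairs, the first has an index foreign to the second; the entry of [W]
    at that index is a centered factor independent of all the others. *)
Let Y_orthogonal (a b : 'I_n * 'I_n) : (a.1 < a.2)%N -> (b.1 < b.2)%N -> a != b ->
  E (fun G => Y a G * Y b G) = 0.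
Proof.
case: a b => [k l] [k' l'] /= kl k'l'; rewrite xpair_eqE => ab.
have kNl : k != l by rewrite -val_eqE /= ltn_eqF.
have k'Nl' : k' != l' by rewrite -val_eqE /= ltn_eqF.
have [kk'|kk'] := boolP ((k != k') && (k != l')).
  case/andP: kk' => kk' kl'.
  rewrite (@eq_mean _ _ K p _ (fun G => W G k i * (W G l i * M G k l * (W G k' i * W G l' i * M G k' l')))); last first.
    by move=> G _; rewrite /Y /=; ring.
  apply: mean_centered_adjacency => G.
  by rewrite !centered_adjacency_toggle_row ?M_toggle // eq_sym.
have [ll'|ll'] := boolP ((l != k') && (l != l')).
  case/andP: ll' => lk' ll'.
  rewrite (@eq_mean _ _ K p _ (fun G => W G l i * (W G k i * M G k l * (W G k' i * W G l' i * M G k' l')))); last first.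
    by move=> G _; rewrite /Y /=; ring.
  apply: mean_centered_adjacency => G.
  by rewrite !centered_adjacency_toggle_row ?M_toggle // eq_sym.
exfalso; move: kk' ll' ab; rewrite !negb_and !negbK -!val_eqE /=.
move: kl k'l'; case: k {kNl} => k ?; case: l => l ?; case: k' {k'Nl'} => k' ?; case: l' => l' ? /=.
lia.
Qed.

(** The form is [2 A + (1 - 2 p) B], with [A] over increasing pairs and [B] linear in the row, both
    sums of orthogonal terms. The constant is 8 + 2, from [(x + y)^2 <= 2 x^2 + 2 y^2]. *)
Lemma centered_quad_form_variance :
  E (fun G => centered_quad_form G ^+ 2) <= 10 * E (fun G => \sum_k \sum_l M G k l ^+ 2).
Proof.
set V := fun G => \sum_k \sum_l M G k l ^+ 2.
have V1 : \sum_(a : 'I_n * 'I_n | (a.1 < a.2)%N) E (fun G => Y a G ^+ 2) <= E V.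
  rewrite -mean_sum; apply: mean_le => // G GK.
  rewrite /V pair_bigA /= [leRHS](bigID (fun a : 'I_n * 'I_n => (a.1 < a.2)%N)) /=.
  apply: ler_wpDr; first by apply: sumr_ge0 => a _; exact: sqr_ge0.
  apply: ler_sum => a _; rewrite /Y !exprMn ler_piMl ?sqr_ge0 //.
  by rewrite mulr_ile1 ?sqr_ge0 ?sqr_centered_adjacency_le1.
have V2 : \sum_k E (fun G => (W G k i * M G k k) ^+ 2) <= E V.
  rewrite -mean_sum; apply: mean_le => // G GK.
  apply: ler_sum => k _; rewrite (bigD1 k) //=; apply: ler_wpDr.
    by apply: sumr_ge0 => l _; exact: sqr_ge0.
  by rewrite exprMn ler_piMl ?sqr_ge0 ?sqr_centered_adjacency_le1.
pose lt2 (a : 'I_n * 'I_n) := (a.1 < a.2)%N.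
pose A G := \sum_(a | lt2 a) Y a G; pose B G := \sum_k W G k i * M G k k.
have EA : E (fun G => A G ^+ 2) <= E V.
  rewrite (@mean_sqr_orthogonal _ _ K p _ lt2 Y); first exact: V1.
  by move=> a b; exact: Y_orthogonal.
have EB : E (fun G => B G ^+ 2) <= E V.
  rewrite (@mean_sqr_orthogonal _ _ K p _ xpredT (fun k G => W G k i * M G k k)).
    exact: V2.
  move=> k l _ _ kl.
  rewrite (@eq_mean _ _ K p _ (fun G => W G k i * (M G k k * (W G l i * M G l l)))); last first.
    by move=> G _; ring.
  apply: mean_centered_adjacency => G.
  by rewrite !centered_adjacency_toggle_row ?M_toggle // eq_sym.
apply: (@le_trans _ _ (E (fun G => 8 * A G ^+ 2 + 2 * B G ^+ 2))); last first.
  by rewrite meanD !meanZ; lra.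
apply: mean_le => // G GK; rewrite quad_formE // -/(A G) -/(B G).
have := sqr_ge0 (2 * A G - (1 - 2 * p) * B G).
have : (1 - 2 * p) ^+ 2 * B G ^+ 2 <= B G ^+ 2.
  by rewrite ler_piMl ?sqr_ge0 //; have := p_ge0; have := p_le1; nra.
nra.
Qed.

End QuadraticForm.

End CenteredAdjacency.

(** * The local law *)

Section NormalizedMatrix.
Local Open Scope complex_scope.
Variables (R : realType) (n : nat) (K : graph n) (p : R).
Hypotheses (p01 : 0 <= p <= 1) (n_gt0 : (0 < n)%N).
Implicit Types (G : graph n) (i k l : 'I_n).
Local Notation normc := (@ComplexField.Normc.normc R).
Local Notation W := (centered_adjacency K p).
Local Notation E := (mean K p).
Let r : R := (Num.sqrt n%:R)^-1.

Definition normalized_adjacency G : 'M[R]_n := (Num.sqrt n%:R)^-1 *: W G.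
(** The variances of the entries of [H]. *)
Definition variance_profile : 'M[R]_n := (n%:R^-1 * (p * (1 - p))) *: adjacency R K.
Local Notation H := normalized_adjacency.
Local Notation S := variance_profile.

Let p_ge0 : 0 <= p. Proof. by case/andP: p01. Qed.
Let p_le1 : p <= 1. Proof. by case/andP: p01. Qed.
Let n0 : 0 < n%:R :> R. Proof. by rewrite ltr0n. Qed.
Let r_gt0 : 0 < r. Proof. by rewrite invr_gt0 sqrtr_gt0. Qed.
Let r2 : r ^+ 2 = n%:R^-1. Proof. by rewrite exprVn sqr_sqrtr ?ler0n. Qed.

Lemma normalized_adjacency_sym G : (H G)^T = H G.
Proof. by rewrite linearZ /= centered_adjacency_sym. Qed.

Lemma normalized_adjacency_diag G i : H G i i = 0.
Proof. by rewrite mxE centered_adjacency_diag mulr0. Qed.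

Lemma normalized_adjacency_col_le1 G i : G \subset K -> \sum_k H G k i ^+ 2 <= 1.
Proof.
move=> GK; apply: (@le_trans _ _ (\sum_(k < n) n%:R^-1)); last first.
  by rewrite sumr_const card_ord -[_ *+ n]mulr_natl mulfV ?gt_eqF.
apply: ler_sum => k _; rewrite mxE exprMn -/r r2 ler_piMr ?invr_ge0 ?ler0n //.
exact: (sqr_centered_adjacency_le1 p01).
Qed.

Lemma variance_profile_sym : S^T = S.
Proof. by rewrite /S linearZ /= adjacency_sym. Qed.

Lemma variance_profile_ge0 i k : 0 <= S i k.
Proof.
have := p_ge0; have := p_le1; move=> ? ?.
by rewrite !mxE mulr_ge0 ?ler0n // mulr_ge0 ?invr_ge0 ?ler0n //; nra.
Qed.

Lemma variance_profile_le i k : S i k <= n%:R^-1.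
Proof.
have := p_ge0; have := p_le1; move=> ? ?.
rewrite !mxE -mulrA ler_piMr ?invr_ge0 ?ler0n //.
by case: (_ && _); rewrite ?mulr1 ?mulr0 //; nra.
Qed.

Lemma variance_profile_diag i : S i i = 0.
Proof. by rewrite !mxE eqxx mulr0. Qed.

Lemma isolate_toggle i k G :
  isolate (H (toggle [set k; i]%SET G)) i = isolate (H G) i.
Proof.
apply/matrixP => u v; rewrite !mxE; case: ifP => // /negbT; rewrite negb_or => /andP[ui vi].
have N : [set u; v]%SET != [set k; i]%SET.
  apply/eqP => /setP /(_ i); rewrite !inE eqxx orbT.
  by rewrite eq_sym (negPf ui) eq_sym (negPf vi).
by rewrite mem_toggle.
Qed.

Definition quad_fluctuation t i G : R[i] :=
  quad_form (H G) t i - \sum_k (S i k)%:C * resolvent (isolate (H G) i) t k k.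

Lemma mean_abs_le (f : graph n -> R) a : 0 < a ->
  E (fun G => `|f G|) <= 2^-1 * (a + a^-1 * E (fun G => f G ^+ 2)).
Proof.
move=> a0; rewrite -[X in _ * (X + _)](mean_cst K p a) -meanZ -meanD -meanZ.
apply: mean_le => // G _; rewrite -[f G ^+ 2]real_normK ?num_real //.
have := sqr_ge0 (a - `|f G|); set x := `|f G| => x2.
rewrite -(ler_pM2l a0) mulrCA mulrDr mulVKf ?gt_eqF //; nra.
Qed.

Section Component.
Variable f : {additive R[i] -> R}.
Hypotheses (fZ : forall (x : R) z, f (x%:C * z) = x * f z)
  (f_le : forall z, f z ^+ 2 <= normc z ^+ 2).

(** [f] stands for the real or the imaginary part, since the variance bound concerns real
    matrices. *)
Lemma mean_quad_fluctuation_component t i : 0 < t ->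
  E (fun G => `|f (quad_fluctuation t i G)|) <= r * (2^-1 + 5 * t ^- 2).
Proof.
move=> t0; pose M G : 'M[R]_n := \matrix_(k, l) f (resolvent (isolate (H G) i) t k l).
have isym G : (isolate (H G) i)^T = isolate (H G) i.
  by rewrite isolate_sym // normalized_adjacency_sym.
have Msym G : (M G)^T = M G.
  by apply/matrixP => k l; rewrite !mxE resolvent_symE.
have Mtog k G : M (toggle [set k; i]%SET G) = M G.
  by apply/matrixP => u v; rewrite !mxE isolate_toggle.
have fE G : f (quad_fluctuation t i G) = n%:R^-1 * centered_quad_form K p i M G.
  rewrite /quad_fluctuation raddfB /= /quad_form mulrBr raddf_sum; congr (_ - _).
    rewrite mulr_sumr; apply: eq_bigr => k _; rewrite raddf_sum mulr_sumr.
    by apply: eq_bigr => l _; rewrite fZ !mxE -/r -r2; ring.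
  rewrite raddf_sum mulr_sumr; apply: eq_bigr => k _.
  by rewrite fZ !mxE; ring.
have V : E (fun G => \sum_k \sum_l M G k l ^+ 2) <= n%:R * t ^- 2.
  rewrite -(mean_cst K p (n%:R * t ^- 2)); apply: mean_le => // G GK.
  have -> : n%:R * t ^- 2 = \sum_(k < n) t ^- 2 :> R by rewrite sumr_const card_ord mulr_natl.
  apply: ler_sum => k _; apply: le_trans (resolvent_row_le t0 (isym G) k).
  by apply: ler_sum => l _; rewrite mxE f_le.
(* The weight [r] balances the two terms, the second moment being of order [r^2]. *)
apply: (le_trans (mean_abs_le _ r_gt0)).
rewrite (@eq_mean _ _ K p _ (fun G => (n%:R ^- 2) * centered_quad_form K p i M G ^+ 2)); last first.
  by move=> G _; rewrite fE exprMn exprVn.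
rewrite meanZ; have Q := centered_quad_form_variance K p01 Msym Mtog.
have {V} Q : n%:R ^- 2 * E (fun G => centered_quad_form K p i M G ^+ 2) <= 10 * r ^+ 2 * t ^- 2.
  rewrite mulrC ler_pdivrMr ?exprn_gt0 // r2.
  rewrite [leRHS](_ : _ = 10 * (n%:R * t ^- 2)); last by field; rewrite !gt_eqF.
  by apply: (le_trans Q); rewrite ler_pM2l.
rewrite mulrDr.
have : r^-1 * (n%:R ^- 2 * E (fun G => centered_quad_form K p i M G ^+ 2)) <= 10 * r * t ^- 2.
  rewrite mulrC ler_pdivrMr //; apply: (le_trans Q).
  by rewrite le_eqVlt; apply/orP; left; apply/eqP; ring.
by rewrite mulrDr; lra.
Qed.

End Component.

Lemma mean_quad_fluctuation t i : 0 < t ->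
  E (fun G => normc (quad_fluctuation t i G)) <= r * (1 + 10 * t ^- 2).
Proof.
move=> t0; have RE := @mean_quad_fluctuation_component (@complex.Re R) (@Re_realM R) _ t i t0.
have IM := @mean_quad_fluctuation_component (@complex.Im R) (@Im_realM R) _ t i t0.
apply: (@le_trans _ _ (E (fun G => `|Re (quad_fluctuation t i G)| + `|Im (quad_fluctuation t i G)|))).
  by apply: mean_le => // G _; exact: normc_ReIm.
rewrite meanD (_ : r * (1 + 10 * t ^- 2) =
   r * (2^-1 + 5 * t ^- 2) + r * (2^-1 + 5 * t ^- 2)); last by field; rewrite gt_eqF.
by apply: lerD; [apply: RE | apply: IM] => z; rewrite sqr_normcE ?lerDl ?lerDr sqr_ge0.
Qed.

(** The 11 is 10 from the fluctuation and 1 from exchanging the resolvents of [H] and of its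
    isolated matrices, as [n^-1 <= r]. *)
Lemma mean_defect t : 0 < t ->
  E (fun G => self_consistency_defect (H G) S t) <= r * (t^-1 * (1 + 11 * t ^- 2)).
Proof.
move=> t0; have tV : 0 < t^-1 by rewrite invr_gt0.
have t2 : 0 <= t ^- 2 by rewrite invr_ge0 exprn_ge0 // ltW.
rewrite meanZ mean_sum ler_pdivrMl //.
have -> : n%:R * (r * (t^-1 * (1 + 11 * t ^- 2))) = \sum_(i < n) r * (t^-1 * (1 + 11 * t ^- 2)).
  by rewrite sumr_const card_ord mulr_natl.
apply: ler_sum => i _.
apply: (@le_trans _ _ (E (fun G => t^-1 * (normc (quad_fluctuation t i G) + n%:R^-1 * t ^- 2)))).
  apply: mean_le => // G GK.
  apply: self_consistency_error => //.
  - exact: normalized_adjacency_sym.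
  - exact: normalized_adjacency_diag.
  - exact: variance_profile_diag.
  - by move=> k; exact: variance_profile_ge0.
  - by move=> k; exact: variance_profile_le.
  - exact: normalized_adjacency_col_le1.
rewrite meanZ meanD mean_cst mulrCA ler_pM2l //.
have rn : n%:R^-1 * t ^- 2 <= r * t ^- 2.
  rewrite ler_wpM2r // -r2 expr2 ler_piMl ?(ltW r_gt0) //.
  rewrite invf_le1 ?sqrtr_gt0 // -[leLHS]sqrtr1 ler_wsqrtr //.
  by rewrite ler1n.
have := mean_quad_fluctuation i t0; lra.
Qed.

End NormalizedMatrix.

Section LocalLaw.
Variable R : realType.
Implicit Types t : R.

(** [C] is fixed before the order, the graph, [p], [sg] and [eta], hence depends on [t] alone; this
    uniformity is what the limit in [n] requires. *)
Definition expected_deviation_bound t := exists2 C : R, 0 <= C &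
  forall (n : nat) (K : graph n) (p sg eta : R), (0 < n)%N -> 0 <= p <= 1 ->
    sg ^+ 2 <= 1 / 4 ->
    (forall i, `|\sum_k variance_profile K p i k - sg ^+ 2| <= eta) ->
    mean K p (fun G => resolvent_deviation sg (normalized_adjacency K p G) t)
      <= C * ((Num.sqrt n%:R)^-1 + eta).

Lemma expected_deviation_bound_start t : 2 <= t -> expected_deviation_bound t.
Proof.
move=> t2; have t0 : 0 < t by lra.
have c0 : 0 <= t^-1 * (1 + 11 * t ^- 2).
  by rewrite mulr_ge0 ?invr_ge0 ?(ltW t0) // addr_ge0 // mulr_ge0 // invr_ge0 exprn_ge0 // ltW.
exists (1 + t^-1 * (1 + 11 * t ^- 2)); first by rewrite addr_ge0.
move=> n K p sg eta n_gt0 p01 sg_le rows.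
have eta0 : 0 <= eta := le_trans (normr_ge0 _) (rows (Ordinal n_gt0)).
have r0 : 0 <= (Num.sqrt n%:R)^-1 :> R by rewrite invr_ge0 sqrtr_ge0.
apply: (@le_trans _ _ (mean K p (fun G =>
   self_consistency_defect (normalized_adjacency K p G) (variance_profile K p) t + eta))).
  apply: mean_le => // G GK; apply: deviation_start => //.
  - exact: normalized_adjacency_sym.
  - exact: variance_profile_ge0.
  - exact: variance_profile_le.
rewrite meanD mean_cst.
have := mean_defect K p01 n_gt0 t0.
set c := t^-1 * _ in c0 *; set r := _^-1 in r0 * => D.
have := mulr_ge0 c0 eta0; rewrite mulrDl mulrDr; nra.
Qed.

Lemma expected_deviation_bound_step t t' : 0 < t -> t <= t' -> t' - t <= t ^+ 3 / 4 ->
  expected_deviation_bound t' -> expected_deviation_bound t.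
Proof.
move=> t0 tt' tau [C' C'0 HC'].
have pos k : 0 <= t ^- k by rewrite invr_ge0 exprn_ge0 // ltW.
have tV : 0 <= t^-1 := pos 1%N.
pose a := 2 * t^-1 * (t^-1 * (1 + 11 * t ^- 2)); pose b := 6 * t ^- 3.
pose c := 4 * t ^- 2 * C'.
have a0 : 0 <= a by rewrite /a !mulr_ge0 // addr_ge0 // mulr_ge0.
have b0 : 0 <= b by rewrite /b mulr_ge0.
have c0 : 0 <= c by rewrite /c !mulr_ge0.
exists (a + b + c); first by rewrite !addr_ge0.
move=> n K p sg eta n_gt0 p01 sg_le rows.
have eta0 : 0 <= eta := le_trans (normr_ge0 _) (rows (Ordinal n_gt0)).
have r0 : 0 <= (Num.sqrt n%:R)^-1 :> R by rewrite invr_ge0 sqrtr_ge0.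
apply: (@le_trans _ _ (mean K p (fun G =>
   2 * t^-1 * self_consistency_defect (normalized_adjacency K p G) (variance_profile K p) t
   + b * eta + 4 * t ^- 2 * resolvent_deviation sg (normalized_adjacency K p G) t'))).
  apply: mean_le => // G GK; apply: deviation_step => //.
  - exact: normalized_adjacency_sym.
  - exact: variance_profile_sym.
  - exact: variance_profile_ge0.
  - exact: variance_profile_le.
rewrite !meanD mean_cst (meanZ _ _ (2 * t^-1)) (meanZ _ _ (4 * t ^- 2)).
have D := mean_defect K p01 n_gt0 t0; have X := HC' n K p sg eta n_gt0 p01 sg_le rows.
move: D X; set r := (Num.sqrt _)^-1 in r0 *; set e := mean _ _ _.
set x := mean _ _ _ => D X.
have D' : 2 * t^-1 * e <= a * r.
  rewrite (_ : a * r = 2 * t^-1 * (r * (t^-1 * (1 + 11 * t ^- 2)))); last by rewrite /a; ring.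
  by rewrite ler_wpM2l // mulr_ge0.
have X' : 4 * t ^- 2 * x <= c * (r + eta) by rewrite /c -[leRHS]mulrA ler_wpM2l // mulr_ge0.
apply: (le_trans (lerD (lerD D' (lexx (b * eta))) X')).
rewrite -subr_ge0 (_ : _ - _ = a * eta + b * r); last by ring.
by rewrite addr_ge0 // mulr_ge0.
Qed.

Lemma expected_deviation_boundP t : 0 < t -> expected_deviation_bound t.
Proof.
move=> t0; pose tau := t ^+ 3 / 4; have tau0 : 0 < tau by rewrite divr_gt0 ?exprn_gt0.
(* The step [tau], fixed at the final [t], is admissible at every [u >= t] because [tau <= u^3 / 4];
   [N] steps suffice to reach 2 from [u]. *)
suff bound N : forall u, t <= u -> 2 <= u + N%:R * tau -> expected_deviation_bound u.
  apply: (bound (Num.bound (2 / tau))) => //.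
  have := archi_boundP (divr_ge0 (ler0n R 2) (ltW tau0)); rewrite ltr_pdivrMr //; lra.
elim: N => [|N IH] u tu; first by rewrite mul0r addr0; exact: expected_deviation_bound_start.
rewrite (_ : N.+1%:R * tau = N%:R * tau + tau) => [u2|]; last by rewrite -natr1 mulrDl mul1r.
apply: (@expected_deviation_bound_step u (u + tau)); first exact: lt_le_trans tu.
- by rewrite lerDl ltW.
- rewrite addrC addKr /tau ler_pM2r ?invr_gt0 // ler_pXn2r ?nnegrE ?(ltW t0) //.
  exact: le_trans (ltW t0) tu.
- by apply: IH; lra.
Qed.

End LocalLaw.

(** * Spectrum and energy *)

Section Spectrum.
Local Open Scope complex_scope.
Variables (R : realType) (n : nat).
Local Notation normc := (@ComplexField.Normc.normc R).

Lemma similar_char_poly (F : fieldType) (A B P : 'M[F]_n) : P \in unitmx ->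
  A = invmx P *m B *m P -> char_poly A = char_poly B.
Proof.
move=> Pu AE; have PAB : P *m A = B *m P by rewrite AE !mulmxA mulmxV // mul1mx.
have E : map_mx polyC P *m char_poly_mx A = char_poly_mx B *m map_mx polyC P.
  by rewrite /char_poly_mx mulmxBr mulmxBl -!map_mxM PAB -scalar_mxC.
have : \det (map_mx (@polyC F) P) != 0.
  by rewrite det_map_mx polyC_eq0 -unitfE -unitmxE.
move/mulfI; apply; have := congr1 determinant E.
by rewrite !det_mulmx [X in _ = X -> _]mulrC.
Qed.

(** All three facts are read off a unitary diagonalization, whose diagonal is matched with
    [eigenvalues] as a multiset through the characteristic polynomial. The scalar [r] lets one [lam]
    serve the energy of [A] and the resolvents of [r *: A]. *)
Lemma symmetric_eigenvalues (A : 'M[R]_n) : A^T = A ->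
  exists lam : 'I_n -> R,
    [/\ \sum_(z <- eigenvalues (complexmx A)) normc z = \sum_i `|lam i|,
        \sum_i lam i ^+ 2 = \sum_i \sum_j A i j ^+ 2 &
        forall r t, 0 < t -> Im (\tr (resolvent (r *: A) t)) =
          \sum_i t / ((r * lam i) ^+ 2 + t ^+ 2)].
Proof.
move=> Asym; set B := complexmx A.
have Breal : B \is a mxOver Num.real.
  by apply/mxOverP => i j; rewrite mxE complex_real.
have Bsym : B \is symmetricmx.
  apply/is_hermitianmxP; rewrite expr0 scale1r; apply/matrixP => i j.
  by rewrite !mxE -[in LHS]Asym mxE.
have Bherm := realsym_hermsym Bsym Breal.
have := hermitian_spectral_diag_real Bherm.
have /orthomx_spectralP := hermitian_normalmx Bherm.
have := spectral_unit B; move: (spectralmx B) (spectral_diag B) => P D Pu BE Dreal.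
pose lam i := Re (D 0 i).
have DE i : D 0 i = (lam i)%:C by rewrite [LHS]complexE RIm_real ?mulr0 ?addr0 //; exact: (mxOverP Dreal).
have tr_sim (M : 'M[R[i]]_n) : \tr (invmx P *m M *m P) = \tr M.
  by rewrite -mulmxA mxtrace_mulC -mulmxA mulmxV // mulmx1.
exists lam; split.
- have eig : perm_eq (eigenvalues B) [seq D 0 i | i : 'I_n].
    apply: prod_XsubC_eq; rewrite -char_poly_eigenvalues (similar_char_poly Pu BE).
    rewrite char_poly_trig ?diag_mx_is_trig // big_image /=.
    by apply: eq_bigr => i _; rewrite mxE eqxx mulr1n.
  transitivity (\sum_(z <- [seq D 0 i | i : 'I_n]) normc z); first exact: perm_big eig.
  by rewrite big_image /=; apply: eq_bigr => i _; rewrite DE normc_real.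
- apply: complexI; rewrite -[LHS]/((\sum_i lam i ^+ 2)%:C) -[RHS]/((\sum_i \sum_j A i j ^+ 2)%:C).
  transitivity (\tr (B *m B)).
    rewrite BE !mulmxA mulmxK // -(mulmxA (invmx P) (diag_mx D)) tr_sim mulmx_diag /mxtrace.
    by rewrite rmorph_sum; apply: eq_bigr => i _; rewrite !mxE eqxx mulr1n DE -rmorphM -expr2.
  rewrite rmorph_sum; apply: eq_bigr => i _; rewrite mxE rmorph_sum.
  apply: eq_bigr => j _; rewrite !mxE expr2 rmorphM; congr (_ * _).
  by rewrite -[in LHS]Asym mxE.
- move=> r t t0; pose d i : R[i] := (r * lam i) +i* (- t).
  have d0 i : d i != 0 by rewrite eq_complex /= oppr_eq0 (gt_eqF t0) andbF.
  have shE : shiftmx (r *: A) t = invmx P *m diag_mx (\row_i d i) *m P.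
    have -> : diag_mx (\row_i d i) = r%:C *: diag_mx D - (0 +i* t)%:M.
      apply/matrixP => i j; rewrite !mxE; case: eqP => [->|_]; last by rewrite !mulr0n mulr0 subr0.
      rewrite !mulr1n DE -rmorphM /d; apply/eqP; rewrite eq_complex /= subr0 sub0r !eqxx.
      by [].
    rewrite mulmxBr mulmxBl -scalemxAr -scalemxAl -BE scalar_mxC -mulmxA mulVmx // mulmx1.
    rewrite /shiftmx; congr (_ - _); apply/matrixP => i j; rewrite !mxE; exact: rmorphM.
  have resE : resolvent (r *: A) t = invmx P *m diag_mx (\row_i (d i)^-1) *m P.
    rewrite -[RHS]mulmx1 -(shiftmxK t0 (H := r *: A)); last by rewrite linearZ /= Asym.
    rewrite mulmxA {1}shE !mulmxA mulmxK // -(mulmxA _ (diag_mx _) (diag_mx _)).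
    rewrite mulmx_diag (_ : \row_i _ = const_mx 1); last first.
      by apply/rowP => i; rewrite !mxE mulVf.
    by rewrite diag_const_mx mulmx1 mulVmx // mul1mx.
  rewrite resE tr_sim /mxtrace Im_sum; apply: eq_bigr => i _.
  by rewrite !mxE eqxx mulr1n /= sqrrN mulNr opprK.
Qed.

End Spectrum.

(** * Complete multipartite graphs: trace perturbation and row variances *)

Section CompleteMultipartite.
Local Open Scope complex_scope.
Variables (R : realType) (n m : nat) (V : 'I_m -> {set 'I_n}).
Hypothesis V_part : vertex_partition V.
Local Notation normc := (@ComplexField.Normc.normc R).
Local Notation K := (complete_multipartite V).

Lemma part_exists u : exists a, u \in V a.
Proof.
have [_ cov] := V_part; have : u \in (\bigcup_i V i)%SET by rewrite cov inE.
by case/bigcupP => a _ ua; exists a.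
Qed.

Lemma part_unique u a b : u \in V a -> u \in V b -> a = b.
Proof.
move=> ua ub; apply/eqP/negPn/negP => ab; have [dis _] := V_part.
by move: (dis a b ab); rewrite disjoint_subset => /fintype.subsetP /(_ u ua); rewrite inE ub.
Qed.

Lemma adjacency_complete_multipartite (F : nzRingType) u v a : u \in V a ->
  adjacency F K u v = (v \notin V a)%:R.
Proof.
move=> ua; rewrite mxE inE cards2; congr (_%:R : F); congr nat_of_bool.
have [uv|uv] := eqVneq u v => /=; first by rewrite -uv ua.
apply/forallP/idP => [/(_ a)|va b]; first by rewrite finset.subUset !finset.sub1set ua.
by rewrite finset.subUset !finset.sub1set negb_and; have [/(part_unique ua) <-|//] := boolP (u \in V b).
Qed.

Lemma card_parts : (\sum_a #|V a| = n)%N.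
Proof.
rewrite -[RHS]card_ord -sum1_card.
rewrite (eq_bigr (fun u => \sum_a (u \in V a))%N) => [|u _].
  rewrite exchange_big; apply: eq_bigr => a _ /=.
  by rewrite -sum1_card big_mkcond; apply: eq_bigr => u _; case: (u \in _).
have [a ua] := part_exists u; rewrite (bigD1 a) //= ua big1 // => b ba.
by apply/eqP; rewrite eqb0; apply: contra ba => ub; apply/eqP/(part_unique ub ua).
Qed.

Definition part_indicator a : 'cV[R[i]]_n := \col_u (u \in V a)%:R.

Lemma sqnorm_part_indicator a : sqnorm (part_indicator a) = #|V a|%:R.
Proof.
rewrite /sqnorm -sum1_card natr_sum [RHS]big_mkcond; apply: eq_bigr => u _.
by rewrite mxE; case: (u \in V a); rewrite ?ComplexField.Normc.normc1 ?normc0 ?expr1n ?expr0n.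
Qed.

Lemma sqnorm_const1 : sqnorm (const_mx 1 : 'cV[R[i]]_n) = n%:R.
Proof.
rewrite /sqnorm (eq_bigr (fun=> 1)) ?sumr_const ?card_ord // => u _.
by rewrite mxE ComplexField.Normc.normc1 expr1n.
Qed.

Lemma complexmx_complete_multipartite :
  complexmx (adjacency R K) = const_mx 1 *m (const_mx 1 : 'cV_n)^T -
    \sum_a part_indicator a *m (part_indicator a)^T.
Proof.
apply/matrixP => u v; rewrite mxE; have [a ua] := part_exists u.
rewrite (adjacency_complete_multipartite R v ua) !mxE summxE !big_ord_recl big_ord0.
rewrite !mxE mulr1 addr0 (bigD1 a) //= big1 => [|b ba]; last first.
  rewrite !mxE big_ord_recl big_ord0 !mxE addr0.
  rewrite (_ : u \in V b = false) ?mul0r //; apply: contraNF ba => ub.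
  by apply/eqP; exact: part_unique ub ua.
rewrite !mxE big_ord_recl big_ord0 !mxE ua mul1r !addr0.
by case: (v \in V a); rewrite /= ?subrr ?subr0.
Qed.

(** In the resolvent identity each rank-one summand costs [t^-2] times its squared norm. The
    all-ones vector accounts for one [n] and all the part indicators together for the other, so [m]
    does not enter. *)
Lemma trace_resolvent_multipartite H H' c t : 0 < t -> 0 <= c ->
  H^T = H -> H'^T = H' -> H - H' = c *: adjacency R K ->
  normc (\tr (resolvent H t) - \tr (resolvent H' t)) <= 2 * c * n%:R * t ^- 2.
Proof.
move=> t0 c0 Hsym Hsym' HH'.
have E : resolvent H t - resolvent H' t =
    - (c%:C *: (resolvent H t *m complexmx (adjacency R K) *m resolvent H' t)).
  have D : shiftmx H' t - shiftmx H t = - (c%:C *: complexmx (adjacency R K)).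
    rewrite /shiftmx opprB addrA subrK; apply/matrixP => k l.
    have := congr1 (fun M : 'M[R]_n => M k l) HH'; rewrite !mxE -rmorphM => <-.
    by rewrite rmorphB opprB.
  rewrite -[resolvent H t in LHS]mulmx1 -(shiftmxK t0 Hsym').
  rewrite -[X in _ - X]mul1mx -(resolventK t0 Hsym) !mulmxA -mulmxBl -mulmxBr D.
  by rewrite mulmxN -scalemxAr mulNmx -scalemxAl.
rewrite -linearB /= E linearN linearZ /= normcN normcM normc_real ger0_norm //.
rewrite [leRHS](_ : _ = c * (t ^- 2 * n%:R + t ^- 2 * n%:R)); last by ring.
rewrite ler_wpM2l // complexmx_complete_multipartite mulmxBr mulmxBl linearB /=.
rewrite (le_trans (normcB_le _ _)) // lerD //.
  by rewrite -sqnorm_const1 trace_resolvent_rank1.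
rewrite mulmx_sumr mulmx_suml linear_sum (le_trans (normc_sum _ _ _)) //=.
have -> : n%:R = \sum_a #|V a|%:R :> R by rewrite -natr_sum card_parts.
rewrite mulr_sumr; apply: ler_sum => a _.
by rewrite -sqnorm_part_indicator trace_resolvent_rank1.
Qed.

Lemma variance_profile_row p u a : (0 < n)%N -> u \in V a ->
  \sum_v variance_profile K p u v = p * (1 - p) * (1 - part_ratio R V a).
Proof.
move=> n_gt0 ua; have n0 : n%:R != 0 :> R by rewrite pnatr_eq0 -lt0n.
under eq_bigr => v _ do rewrite mxE (adjacency_complete_multipartite R v ua).
rewrite -mulr_sumr -natr_sum (_ : (\sum_v (v \notin V a) = n - #|V a|)%N).
  have le_n : (#|V a| <= n)%N by rewrite -[X in (_ <= X)%N]card_ord max_card.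
  rewrite natrB // /part_ratio; move: (#|V a|%:R : R) n0 => c n0.
  by field.
have cardC := cardsC (V a); rewrite card_ord in cardC.
transitivity #|(~: V a)%SET|; last by lia.
rewrite -sum1_card [RHS]big_mkcond.
by apply: eq_bigr => v _; rewrite inE; case: (v \in V a).
Qed.

End CompleteMultipartite.

(** * Riemann sums for Coulson's formula and for the semicircle law *)

Section RiemannSums.
Variable R : realType.
Implicit Types (x h : R) (N : nat).

(** [F] stands for a primitive of a decreasing integrand [phi], both sampled with mesh [h]; the
    comparison needs no integral. *)
Lemma antitone_riemann_sum (F phi : nat -> R) h N : 0 <= h -> (forall k, 0 <= phi k) ->
  (forall k, h * phi k.+1 <= F k.+1 - F k <= h * phi k) ->
  h * (\sum_(k < N) phi k.+1) <= F N - F 0%N <= h * phi 0%N + h * (\sum_(k < N) phi k.+1).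
Proof.
move=> h0 phi0 step.
(* Keeping [h * phi N] on the left of the upper bound makes it telescope. *)
suff : h * (\sum_(k < N) phi k.+1) <= F N - F 0%N /\
    F N - F 0%N + h * phi N <= h * phi 0%N + h * (\sum_(k < N) phi k.+1).
  by case=> -> D; have := mulr_ge0 h0 (phi0 N); lra.
elim: N => [|N [IH1 IH2]]; first by rewrite big_ord0 mulr0; split; lra.
by rewrite !big_ord_recr /= !mulrDr; have /andP[s1 s2] := step N; split; lra.
Qed.

Lemma atan_increment (a b : R) : 0 <= a -> a <= b ->
  (b - a) / (1 + b ^+ 2) <= atan b - atan a <= (b - a) / (1 + a ^+ 2).
Proof.
move=> a0; rewrite le_eqVlt => /predU1P[<-|ab]; first by rewrite !subrr !mul0r lexx.
have datan (z : R) : z \in `]a, b[ -> is_derive z 1 atan (1 + z ^+ 2)^-1.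
  by move=> _; exact: is_derive1_atan.
have catan : {within `[a, b], continuous (@atan R)}.
  by apply: derivable_within_continuous => z _; exact: ex_derive.
have [c] := MVT ab datan catan; rewrite in_itv /= => /andP[ac cb] ->.
have pos (z : R) : 0 < 1 + z ^+ 2 by rewrite ltr_pwDl // sqr_ge0.
rewrite mulrC ![(b - a) * _]mulrC !ler_pM2r ?subr_gt0 //.
rewrite !lef_pV2 ?posrE // !lerD2l !ler_pXn2r ?nnegrE //; lra.
Qed.

(** [pi / 2 - atan y] is the arctangent of [y^-1], hence at most [y^-1]. This bounds the tail of
    Coulson's integral. *)
Lemma atan_ge (y : R) : 0 < y -> pi / 2 - y^-1 <= atan y.
Proof.
move=> y0; have a0 : 0 < atan y by rewrite -(atan0 R) lt_atan.
have aV : atan y < pi / 2 := atan_ltpi2 y.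
have tanV : tan (pi / 2 - atan y) = y^-1.
  rewrite -[in RHS](atanK y) /tan sinB cosB sin_pihalf cos_pihalf.
  by rewrite !mul0r !mul1r subr0 add0r invf_div.
have in_dom : pi / 2 - atan y \in `](- (pi / 2)), (pi / 2)[.
  by rewrite in_itv /=; have := pi_gt0 R; lra.
have /andP[_] := @atan_increment 0 y^-1 (lexx _) (ltW (eqbRL (invr_gt0 y) y0)).
by rewrite -[in X in X -> _]tanV tanK // atan0 expr0n addr0 divr1 !subr0 tanV; lra.
Qed.

(* A Riemann sum for |x| = (2 / pi) * \int_0^oo x^2 / (x^2 + t^2) dt, Coulson's formula. *)
Lemma coulson_riemann_sum x h N : 0 < h -> (0 < N)%N ->
  `| `|x| - 2 / pi * (h * \sum_(k < N) x ^+ 2 / (x ^+ 2 + (k.+1%:R * h) ^+ 2)) |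
    <= h + x ^+ 2 / (N%:R * h).
Proof.
move=> h0 N0; have N0' : 0 < N%:R :> R by rewrite ltr0n.
have Nh : 0 < N%:R * h by rewrite mulr_gt0.
wlog x0 : x / 0 < x => [wl|].
  have [|x0|x0] := ltgtP x 0; last 2 first.
  - exact: wl.
  - rewrite x0 normr0 expr0n mul0r big1 => [|k _]; last by rewrite mul0r.
    by rewrite !mulr0 subr0 normr0 addr0 ltW.
  by rewrite -oppr_gt0 => /wl; rewrite normrN sqrrN.
rewrite (gtr0_norm x0); set S := h * _.
pose phi k : R := x ^+ 2 / (x ^+ 2 + (k%:R * h) ^+ 2).
(* A primitive of [x^2 / (x^2 + t^2)] is [x * atan (t / x)]. The error [h] comes from [phi 0 = 1],
   the other one from stopping at [N * h]. *)
pose F k : R := x * atan (k%:R * h / x).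
have den k : 0 < x ^+ 2 + (k%:R * h) ^+ 2 by rewrite ltr_pwDl ?exprn_gt0 // sqr_ge0.
have phi0 k : 0 <= phi k by rewrite divr_ge0 ?sqr_ge0 // ltW.
have step k : h * phi k.+1 <= F k.+1 - F k <= h * phi k.
  have a0 : 0 <= k%:R * h / x by rewrite divr_ge0 ?mulr_ge0 ?ler0n // ltW.
  have ab : k%:R * h / x <= k.+1%:R * h / x.
    by rewrite ler_pM2r ?invr_gt0 // ler_pM2r // ler_nat.
  have := atan_increment a0 ab.
  have conv j : h * phi j = x * ((k.+1%:R * h / x - k%:R * h / x) / (1 + (j%:R * h / x) ^+ 2)).
    rewrite /phi -natr1; field; rewrite !gt_eqF //.
  by rewrite !conv -mulrBr !ler_pM2l.
have /andP[] := antitone_riemann_sum N (ltW h0) phi0 step.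
rewrite -/S {2 4}/F mul0r mul0r atan0 mulr0 !subr0.
have -> : phi 0%N = 1 by rewrite /phi mul0r expr0n addr0 divff // gt_eqF // exprn_gt0.
rewrite mulr1 => S_le S_ge.
have F_le : F N <= x * (pi / 2) by rewrite ler_pM2l // ltW // atan_ltpi2.
have F_ge : x * (pi / 2) - x ^+ 2 / (N%:R * h) <= F N.
  rewrite [leLHS](_ : _ = x * (pi / 2 - (N%:R * h / x)^-1)); last first.
    by field; rewrite !gt_eqF.
  by rewrite ler_pM2l // atan_ge // divr_gt0.
have pi2 : 0 <= 2 / (pi : R) <= 1.
  by rewrite divr_ge0 ?pi_ge0 //= ler_pdivrMr ?pi_gt0 // mul1r pi_ge2.
rewrite [X in `|X - _|](_ : x = 2 / pi * (x * (pi / 2))); last first.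
  by move: (lt0r_neq0 (pi_gt0 R)); move: (pi : R) => c c0; field.
case/andP: pi2 => pi0 pi1; rewrite -mulrBr normrM ger0_norm //.
rewrite ger0_norm ?subr_ge0; last by lra.
apply: (@le_trans _ _ (x * (pi / 2) - S)); last by lra.
by rewrite ler_piMl // subr_ge0; lra.
Qed.

(** The integral of [sg^2 s(t)^2] is computed with [s] as the variable: [t = s^-1 - sg^2 s] turns
    [sg^2 s^2 dt] into [- (sg^2 + sg^4 s^2) ds], and [s] decreases from [sg^-1] to 0. *)
Lemma semicircle_riemann_sum sg h N : 0 <= sg -> sg ^+ 2 <= 1 / 4 -> 0 < h -> (0 < N)%N ->
  `| h * (\sum_(k < N) sg ^+ 2 * stieltjes sg (k.+1%:R * h) ^+ 2) - 4 / 3 * sg |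
    <= h + (N%:R * h)^-1.
Proof.
move=> sg0 sg_le h0 N0; have Nh : 0 < N%:R * h by rewrite mulr_gt0 // ltr0n.
move: sg0; rewrite le_eqVlt => /predU1P[<-|sg0].
  rewrite big1 => [|k _]; last by rewrite expr0n mul0r.
  by rewrite !mulr0 subrr normr0 addr_ge0 ?invr_ge0 // ltW.
(* The value at [t = 0] is the root [sg^-1], where the primitive [F] below equals
   [- (4 / 3 * sg)]. *)
pose s k : R := if k is j.+1 then stieltjes sg (k%:R * h) else sg^-1.
have t0 k : 0 < k.+1%:R * h by rewrite mulr_gt0 // ltr0n.
have s0 k : 0 < s k by case: k => [|k] /=; [rewrite invr_gt0 | exact: stieltjes_gt0].
have sE k : s k * (k%:R * h) + sg ^+ 2 * s k ^+ 2 = 1.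
  case: k => [|k] /=; last exact: stieltjes_eq.
  by rewrite mul0r mulr0 add0r exprVn mulfV // gt_eqF // exprn_gt0.
have incr k : h = (s k - s k.+1) * ((s k * s k.+1)^-1 + sg ^+ 2).
  rewrite -(stieltjes_increment (s0 k) (s0 k.+1) (sE k) (sE k.+1)).
  by rewrite -mulrBl -natr1 addrC addKr mul1r.
pose phi k : R := sg ^+ 2 * s k ^+ 2.
pose F k : R := - (sg ^+ 2 * s k + (sg ^+ 2) ^+ 2 * s k ^+ 3 / 3).
have phi0 k : 0 <= phi k by rewrite mulr_ge0 ?sqr_ge0.
have dec k : 0 < s k - s k.+1.
  rewrite -(pmulr_lgt0 _ (x := (s k * s k.+1)^-1 + sg ^+ 2)) -?incr //.
  by rewrite ltr_wpDr ?sqr_ge0 // invr_gt0 mulr_gt0.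
have step k : h * phi k.+1 <= F k.+1 - F k <= h * phi k.
  have := dec k; have := s0 k; have := s0 k.+1; rewrite (incr k) /phi /F.
  move: (s k) (s k.+1) => u v v0 u0 uv.
  have c0 : 0 < sg ^+ 2 * (u - v) by rewrite mulr_gt0 // exprn_gt0.
  have vu : v / u <= 1 by rewrite ler_pdivrMr //; lra.
  have uv' : 1 <= u / v by rewrite ler_pdivlMr //; lra.
  have g0 : 0 <= sg ^+ 2 := sqr_ge0 sg.
  rewrite [X in X <= _](_ : _ = sg ^+ 2 * (u - v) * (v / u + sg ^+ 2 * v ^+ 2)); last first.
    by field; rewrite !gt_eqF.
  rewrite [X in _ <= X <= _](_ : _ = sg ^+ 2 * (u - v) *
    (1 + sg ^+ 2 * ((u ^+ 2 + u * v + v ^+ 2) / 3))); last by field.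
  rewrite [X in _ <= _ <= X](_ : _ = sg ^+ 2 * (u - v) * (u / v + sg ^+ 2 * u ^+ 2)); last first.
    by field; rewrite !gt_eqF.
  by rewrite !ler_pM2l //; apply/andP; split; apply: lerD => //; apply: ler_wpM2l => //; nra.
have /andP[] := antitone_riemann_sum N (ltW h0) phi0 step.
have -> : phi 0%N = 1 by rewrite /phi /= exprVn mulfV // gt_eqF // exprn_gt0.
have -> : F 0%N = - (4 / 3 * sg) by rewrite /F /=; field; rewrite gt_eqF.
rewrite /phi /= opprK mulr1 => S_le S_ge.
have FN : - (N%:R * h)^-1 <= F N <= 0.
  have sN : s N <= (N%:R * h)^-1.
    by case: N N0 {Nh S_le S_ge} => // N _; exact: stieltjes_le.
  have ss : sg ^+ 2 * s N ^+ 2 <= 1.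
    by have := mulr_ge0 (ltW (s0 N)) (ltW Nh); have := sE N; lra.
  rewrite /F; have sN0 := s0 N; have g0 := sqr_ge0 sg; move: (s N) sN ss sN0 => u uN ss u0.
  have u3 : (sg ^+ 2) ^+ 2 * u ^+ 3 <= sg ^+ 2 * u.
    rewrite [leLHS](_ : _ = sg ^+ 2 * u * (sg ^+ 2 * u ^+ 2)); last by ring.
    by rewrite ler_piMr // mulr_ge0 // ltW.
  have u30 : 0 <= (sg ^+ 2) ^+ 2 * u ^+ 3 by rewrite mulr_ge0 ?sqr_ge0 ?exprn_ge0 // ltW.
  have : sg ^+ 2 * u <= 1 / 4 * u by rewrite ler_pM2r.
  have : 0 <= sg ^+ 2 * u by rewrite mulr_ge0 // ltW.
  by move=> ? ?; apply/andP; split; lra.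
case/andP: FN => FN1 FN2; rewrite ler_norml; apply/andP; split; lra.
Qed.

End RiemannSums.

(** * From traces of resolvents to the energy *)

Section EnergyConcentration.
Local Open Scope complex_scope.
Variables (R : realType) (n m : nat) (V : 'I_m -> {set 'I_n}) (p sg : R).
Hypotheses (V_part : vertex_partition V) (n_gt0 : (0 < n)%N) (p01 : 0 <= p <= 1)
  (sg_ge0 : 0 <= sg) (sg_le : sg ^+ 2 <= 1 / 4).
Local Notation normc := (@ComplexField.Normc.normc R).
Local Notation K := (complete_multipartite V).
Local Notation H := (normalized_adjacency K p).
Let r : R := (Num.sqrt n%:R)^-1.

Let n0 : 0 < n%:R :> R. Proof. by rewrite ltr0n. Qed.
Let r_gt0 : 0 < r. Proof. by rewrite invr_gt0 sqrtr_gt0. Qed.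
Let r2 : r ^+ 2 = n%:R^-1. Proof. by rewrite exprVn sqr_sqrtr ?ler0n. Qed.

Lemma complexmx_adjacency (G : graph n) : complexmx (adjacency R G) = adjacency R[i] G.
Proof. by apply/matrixP => i j; rewrite !mxE rmorph_nat. Qed.

Lemma trace_resolvent_adjacency (G : graph n) t : 0 < t ->
  `| n%:R^-1 * Im (\tr (resolvent (r *: adjacency R G) t)) - stieltjes sg t | <=
  resolvent_deviation sg (H G) t + 2 * r * t ^- 2.
Proof.
move=> t0; set A := r *: adjacency R G; have [p0 p1] := andP p01.
have Asym : A^T = A by rewrite linearZ /= adjacency_sym.
have AH : A - H G = (r * p) *: adjacency R K.
  by rewrite /H /centered_adjacency -/r scalerBr opprB addrC subrK scalerA.
have := trace_resolvent_multipartite V_part t0 (mulr_ge0 (ltW r_gt0) p0) Asym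
  (normalized_adjacency_sym K p G) AH.
set a := \tr _; set b := \tr _ => ab.
have dev : `|n%:R^-1 * Im b - stieltjes sg t| <= resolvent_deviation sg (H G) t.
  rewrite (_ : _ - _ = n%:R^-1 * Im (\sum_i (resolvent (H G) t i i - (0 +i* stieltjes sg t)))).
    rewrite normrM gtr0_norm ?invr_gt0 // ler_wpM2l ?invr_ge0 ?ler0n //.
    by rewrite (le_trans (normc_Im _)) // normc_sum.
  rewrite sumrB raddfB /= sumr_const card_ord raddfMn /= -[stieltjes _ _ *+ n]mulr_natl mulrBr.
  by rewrite mulKf ?gt_eqF.
have diff : `|n%:R^-1 * Im a - n%:R^-1 * Im b| <= 2 * r * t ^- 2.
  rewrite -mulrBr -raddfB normrM gtr0_norm ?invr_gt0 // ler_pdivrMl //.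
  apply: (le_trans (normc_Im _)); apply: (le_trans ab).
  rewrite [leLHS](_ : _ = p * (n%:R * (2 * r * t ^- 2))); last by ring.
  rewrite ler_piMl // mulr_ge0 ?ler0n // mulr_ge0 //; last first.
    by rewrite invr_ge0 exprn_ge0 // ltW.
  by rewrite mulr_ge0 // (ltW r_gt0).
rewrite (_ : _ - stieltjes sg t = (n%:R^-1 * Im b - stieltjes sg t) +
  (n%:R^-1 * Im a - n%:R^-1 * Im b)); last by ring.
by rewrite (le_trans (ler_normD _ _)) // lerD.
Qed.

(** [r^3] times the energy is the mean of [|x|] over the eigenvalues [x] of [r A]. Coulson's sum and
    the semicircle sum each cost [h + (N h)^-1]; between them, each grid point costs its trace error
    times [t]. *)
Lemma energy_approximation (G : graph n) h N : 0 < h -> (0 < N)%N ->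
  `| r ^+ 3 * energy R G - 8 / (3 * pi) * sg | <=
  2 * h + 2 / (N%:R * h) +
  h * \sum_(k < N) ((k.+1%:R * h) * resolvent_deviation sg (H G) (k.+1%:R * h)
     + 2 * r / (k.+1%:R * h)).
Proof.
move=> h0 N0; have Nh : 0 < N%:R * h by rewrite mulr_gt0 // ltr0n.
set Z := h * \sum_(k < N) (_ + _); pose t k : R := k.+1%:R * h; have t0 k : 0 < t k by rewrite mulr_gt0 // ltr0n.
have [lam [energyE sqrE resE]] := symmetric_eigenvalues (adjacency_sym R G).
pose x i := r * lam i.
pose S i := h * \sum_(k < N) x i ^+ 2 / (x i ^+ 2 + t k ^+ 2).
have pi2 : 0 <= 2 / (pi : R) <= 1.
  by rewrite divr_ge0 ?pi_ge0 //= ler_pdivrMr ?pi_gt0 // mul1r pi_ge2.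
case/andP: pi2 => pi0 pi1.
(* Adjacency entries are 0 or 1, so the [x i ^+ 2] average to at most 1, and the truncation errors
   of Coulson's sums to at most [(N h)^-1]. *)
have x2 : n%:R^-1 * \sum_i x i ^+ 2 <= 1.
  rewrite ler_pdivrMl // mulr1 (eq_bigr (fun i => n%:R^-1 * lam i ^+ 2)); last first.
    by move=> i _; rewrite exprMn r2.
  rewrite -mulr_sumr sqrE ler_pdivrMl //.
  have -> : n%:R * n%:R = \sum_(i < n) \sum_(j < n) 1 :> R.
    by rewrite !sumr_const !card_ord mulr_natr.
  apply: ler_sum => i _; apply: ler_sum => j _.
  by rewrite mxE; case: (_ && _); rewrite ?expr1n ?expr0n.
have part1 : `|r ^+ 3 * energy R G - n%:R^-1 * \sum_i 2 / pi * S i| <= h + (N%:R * h)^-1.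
  have -> : r ^+ 3 * energy R G = n%:R^-1 * \sum_i `|x i|.
    rewrite /energy -complexmx_adjacency energyE -r2 exprSr -mulrA; congr (_ * _).
    by rewrite mulr_sumr; apply: eq_bigr => i _; rewrite /x normrM gtr0_norm.
  rewrite -mulrBr -sumrB normrM gtr0_norm ?invr_gt0 //.
  apply: (@le_trans _ _ (n%:R^-1 * \sum_i (h + x i ^+ 2 / (N%:R * h)))).
    rewrite ler_wpM2l ?invr_ge0 ?ler0n // (le_trans (ler_norm_sum _ _ _)) //.
    by apply: ler_sum => i _; exact: coulson_riemann_sum.
  rewrite big_split /= sumr_const card_ord -mulr_suml mulrDr -[h *+ n]mulr_natl mulKf ?gt_eqF //.
  by rewrite lerD2l mulrA ler_piMl // invr_ge0 ltW.
have part2 : `|n%:R^-1 * \sum_i 2 / pi * S i -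
    2 / pi * (h * \sum_(k < N) sg ^+ 2 * stieltjes sg (t k) ^+ 2)| <= Z.
  have -> : n%:R^-1 * \sum_i 2 / pi * S i =
      2 / pi * (h * \sum_(k < N) n%:R^-1 * \sum_i x i ^+ 2 / (x i ^+ 2 + t k ^+ 2)).
    rewrite -mulr_sumr mulrCA; congr (_ * _).
    by rewrite -!mulr_sumr mulrCA exchange_big.
  rewrite -!mulrBr -sumrB normrM ger0_norm //.
  rewrite (le_trans (ler_piMl _ pi1)) // normrM gtr0_norm // /Z ler_pM2l //.
  rewrite (le_trans (ler_norm_sum _ _ _)) //; apply: ler_sum => k _.
  (* Since [x^2 / (x^2 + t^2) = 1 - t * (t / (x^2 + t^2))], the summand is a trace; likewise
     [sg^2 s^2 = 1 - t s] for the limit. *)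
  have -> : n%:R^-1 * \sum_i x i ^+ 2 / (x i ^+ 2 + t k ^+ 2) =
      1 - t k * (n%:R^-1 * Im (\tr (resolvent (r *: adjacency R G) (t k)))).
    rewrite resE // mulrCA [t k * _]mulr_sumr.
    rewrite [X in _ = X - _](_ : _ = n%:R^-1 * \sum_(i < n) 1); last first.
      by rewrite sumr_const card_ord mulVf ?gt_eqF.
    rewrite -mulrBr -sumrB; congr (_ * _); apply: eq_bigr => i _.
    have : x i ^+ 2 + t k ^+ 2 != 0 by rewrite gt_eqF // ltr_wpDl ?sqr_ge0 // exprn_gt0.
    by rewrite -/(x i) => ?; field.
  rewrite -[X in X - _ - _](stieltjes_eq sg (t0 k)).
  rewrite (_ : _ - _ = - (t k * (n%:R^-1 * Im (\tr (resolvent (r *: adjacency R G) (t k)))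
     - stieltjes sg (t k)))); last by ring.
  rewrite normrN normrM gtr0_norm //.
  rewrite -/(t k) (_ : t k * resolvent_deviation sg (H G) (t k) + 2 * r / t k =
      t k * (resolvent_deviation sg (H G) (t k) + 2 * r * t k ^- 2)); last first.
    by field; rewrite gt_eqF.
  by rewrite ler_pM2l // trace_resolvent_adjacency.
have part3 : `|2 / pi * (h * \sum_(k < N) sg ^+ 2 * stieltjes sg (t k) ^+ 2) -
    8 / (3 * pi) * sg| <= h + (N%:R * h)^-1.
  have -> : 8 / (3 * pi) * sg = 2 / pi * (4 / 3 * sg) 
    by move: (lt0r_neq0 (pi_gt0 R)); move: (pi : R) => u u0; field.
  rewrite -mulrBr normrM ger0_norm // (le_trans (ler_piMl _ pi1)) //.
  exact: semicircle_riemann_sum.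
move: part1 part2 part3; set a := r ^+ 3 * _; set b := n%:R^-1 * _; set c := 2 / pi * _.
set d := 8 / _ * _ => p1 p2 p3.
rewrite (_ : a - d = (a - b) + ((b - c) + (c - d))); last by ring.
apply: (le_trans (ler_normD _ _)).
have := ler_normD (b - c) (c - d); move: p1 p2 p3; move: (`|_|) (`|_|) (`|_|) => u v w; lra.
Qed.

End EnergyConcentration.

Lemma mean_energy_bound (R : realType) (eps : R) : 0 < eps -> exists2 C : R, 0 <= C &
  forall (n m : nat) (V : 'I_m -> {set 'I_n}) (p sg eta : R), (0 < n)%N ->
    vertex_partition V -> 0 <= p <= 1 -> 0 <= sg -> sg ^+ 2 <= 1 / 4 ->
    (forall i, `|\sum_k variance_profile (complete_multipartite V) p i k - sg ^+ 2| <= eta) ->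
    mean (complete_multipartite V) p
      (fun G => `|(Num.sqrt n%:R)^-1 ^+ 3 * energy R G - 8 / (3 * pi) * sg|)
      <= eps + C * ((Num.sqrt n%:R)^-1 + eta).
Proof.
(* [2 h] takes [eps / 4], and [N] is chosen to leave at most [eps / 2] for [2 / (N h)]. Both depend
   on [eps] only, so [C] collects finitely many constants. *)
move=> eps0; pose h := eps / 8; have h0 : 0 < h by rewrite divr_gt0.
pose N := (Num.bound (4 / (h * eps))).+1.
have N0 : 0 < N%:R :> R by rewrite ltr0n.
have N_ge : 2 / (N%:R * h) <= eps / 2.
  have q0 : 0 <= 4 / (h * eps) by rewrite divr_ge0 // ltW // mulr_gt0.
  have : 4 / (h * eps) < N%:R.
    by rewrite (lt_le_trans (archi_boundP q0)) // ler_nat.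
  rewrite ltr_pdivrMr ?mulr_gt0 // => ?.
  by rewrite ler_pdivrMr ?mulr_gt0 //; lra.
pose t k : R := k.+1%:R * h; have t0 k : 0 < t k by rewrite mulr_gt0 // ltr0n.
have bound k := cid2 (expected_deviation_boundP (t0 k)).
pose c k := s2val (bound k); have c0 k : 0 <= c k := s2valP (bound k).
have cP k := s2valP' (bound k).
exists (h * \sum_(k < N) (t k * c k + 2 / t k)).
  rewrite mulr_ge0 ?(ltW h0) // sumr_ge0 // => k _.
  by rewrite addr_ge0 ?divr_ge0 ?mulr_ge0 // ltW.
move=> n m V p sg eta n_gt0 Vp p01 sg0 sg_le rows.
have eta0 : 0 <= eta := le_trans (normr_ge0 _) (rows (Ordinal n_gt0)).
set r := (Num.sqrt n%:R)^-1; have r0 : 0 <= r by rewrite invr_ge0 sqrtr_ge0.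
set K := complete_multipartite V.
apply: (@le_trans _ _ (mean K p (fun G => (2 * h + 2 / (N%:R * h)) +
  h * \sum_(k < N) (t k * resolvent_deviation sg (normalized_adjacency K p G) (t k)
     + 2 * r / t k)))).
  by apply: mean_le => // G _; exact: energy_approximation.
rewrite meanD mean_cst (meanZ _ _ h) mean_sum lerD //; first by have -> : 2 * h = eps / 4; [rewrite /h; field | lra].
rewrite -mulrA ler_pM2l // mulr_suml; apply: ler_sum => k _.
rewrite meanD mean_cst (meanZ _ _ (t k)) [leRHS]mulrDl lerD //.
  by rewrite -mulrA ler_pM2l //; exact: cP.
by rewrite mulrAC ler_pM2l ?divr_gt0 // lerDl.
Qed.

(** * Balanced parts and passage to the limit *)

Section BalancedParts.
Variables (R : realType) (n m : nat) (V : 'I_m -> {set 'I_n}).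
Hypotheses (V_part : vertex_partition V) (n_gt0 : (0 < n)%N) (m_gt0 : (0 < m)%N).
Local Notation nu := (part_ratio R V).

Lemma sum_part_ratio : \sum_a nu a = 1.
Proof.
rewrite -mulr_suml -natr_sum (card_parts V_part) divff //.
by rewrite pnatr_eq0 -lt0n.
Qed.

Lemma part_ratio_le1 a : nu a <= 1.
Proof.
rewrite -sum_part_ratio (bigD1 a) //= lerDl sumr_ge0 // => b _.
by rewrite divr_ge0 ?ler0n.
Qed.

(** [m^-1] is the mean of the ratios, so like [nu c] it lies between the least and the greatest of
    them; dividing their difference by [nu b <= 1] only enlarges it. *)
Lemma part_ratio_spread (a b c : 'I_m) : (forall i, nu a <= nu i) -> (forall i, nu i <= nu b) ->
  `|nu c - m%:R^-1| <= 1 - nu a / nu b.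
Proof.
move=> amin bmax; have m0 : 0 < m%:R :> R by rewrite ltr0n.
have a_le : nu a <= m%:R^-1.
  rewrite -[leRHS]mulr1 ler_pdivlMl // -[leRHS]sum_part_ratio mulr_natl -[X in _ *+ X]card_ord -sumr_const.
  exact: ler_sum.
have b_ge : m%:R^-1 <= nu b.
  rewrite -[leLHS]mulr1 ler_pdivrMl // -[leLHS]sum_part_ratio mulr_natl.
  by rewrite -[X in _ *+ X]card_ord -sumr_const; exact: ler_sum.
have b0 : 0 < nu b by rewrite (lt_le_trans _ b_ge) // invr_gt0.
apply: (@le_trans _ _ (nu b - nu a)).
  rewrite ler_norml; have := amin c; have := bmax c.
  by move=> ? ?; apply/andP; split; lra.
rewrite (_ : 1 - _ = (nu b - nu a) / nu b); last by field; rewrite gt_eqF.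
by rewrite ler_pdivlMr // ler_piMr ?part_ratio_le1 // subr_ge0.
Qed.

End BalancedParts.

Lemma random_subgraph_prob_le1 (R : realType) (n : nat) (K : graph n) (p : R) (Q : pred (graph n)) :
  0 <= p <= 1 -> random_subgraph_prob K p Q <= 1.
Proof.
move=> p01; rewrite -(random_subgraph_probT K p) /random_subgraph_prob big_mkcondr.
rewrite [leRHS](eq_bigl (fun G => G \in powerset K)) => [|G]; last by rewrite andbT.
apply: ler_sum => G _; have := subgraph_weight_ge0 K p01 G.
by case: (Q G).
Qed.

Lemma powR_three_halves (R : realType) (x : R) : 0 < x ->
  x `^ (3 / 2) = Num.sqrt x ^+ 3.
Proof.
move=> x0; rewrite mulrC powRrM powR12_sqrt ?(ltW x0) //.
by rewrite powR_mulrn ?sqrtr_ge0.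
Qed.

Theorem mainTheorem3 (R : realType) (p : R) (p01 : 0 <= p <= 1)
  (m : nat -> nat) (m_ge2 : forall n : nat, (2 <= m n)%N)
  (V : forall n : nat, 'I_(m n) -> {set 'I_n})
  (V_part : forall n : nat, vertex_partition (V n))
  (max_cvg : cvgn (fun n : nat =>
     \big[Num.max/0]_(i < m n) part_ratio R (V n) i))
  (max_lim_gt0 : 0 < limn (fun n : nat =>
     \big[Num.max/0]_(i < m n) part_ratio R (V n) i))
  (ratio_lim : forall i j : (forall n : nat, 'I_(m n)),
     part_ratio R (V n) (i n) / part_ratio R (V n) (j n)
       @[n --> \oo] --> (1 : R)) :
  exists2 delta : nat -> R, delta n @[n --> \oo] --> (0 : R) &
    almost_every_multipartite V p (fun n G =>
      `| energy R G - n%:R `^ (3 / 2) *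
           (8 / (3 * pi) * Num.sqrt (((m n)%:R - 1) / (m n)%:R * (p * (1 - p)))) |
      <= n%:R `^ (3 / 2) * delta n).
Proof.
pose sg n : R := Num.sqrt (((m n)%:R - 1) / (m n)%:R * (p * (1 - p))).
pose K n := complete_multipartite (V n).
pose r n : R := (Num.sqrt n%:R)^-1.
pose dev n (G : graph n) : R := `|r n ^+ 3 * energy R G - 8 / (3 * pi) * sg n|.
pose u n := mean (K n) p (@dev n).
have m_gt0 n : (0 < m n)%N := ltnW (m_ge2 n).
have mR n : 0 < (m n)%:R :> R by rewrite ltr0n.
pose i0 n := Ordinal (m_gt0 n).
(* [ratio_lim] covers arbitrary sequences of parts, hence a smallest and a largest part chosen for
   each [n]: the ratios converge uniformly over the parts, even if [m n] grows. *)
pose a n : 'I_(m n) := [arg min_(i < i0 n) part_ratio R (V n) i]%O.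
pose b n : 'I_(m n) := [arg max_(i > i0 n) part_ratio R (V n) i]%O.
have amin n i : part_ratio R (V n) (a n) <= part_ratio R (V n) i.
  by rewrite /a; case: arg_minP => // j _; exact.
have bmax n i : part_ratio R (V n) i <= part_ratio R (V n) (b n).
  by rewrite /b; case: arg_maxP => // j _; exact.
pose eta n : R := 1 - part_ratio R (V n) (a n) / part_ratio R (V n) (b n).
have [p0 p1] := andP p01.
have pq0 : 0 <= p * (1 - p) by rewrite mulr_ge0 // subr_ge0.
have pq4 : p * (1 - p) <= 1 / 4 by have := sqr_ge0 (p - 1 / 2); nra.
have sg0 n : 0 <= sg n by rewrite sqrtr_ge0.
have sg2 n : sg n ^+ 2 = (1 - (m n)%:R^-1) * (p * (1 - p)).
  rewrite sqr_sqrtr; first by rewrite mulrBl mul1r divff ?gt_eqF ?mR.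
  by rewrite mulr_ge0 // divr_ge0 ?ler0n // subr_ge0 ler1n m_gt0.
have mV n : 0 <= ((m n)%:R^-1 : R) <= 1.
  by apply/andP; split; [rewrite invr_ge0 ler0n | rewrite invf_le1 ?mR // ler1n m_gt0].
have sg_le n : sg n ^+ 2 <= 1 / 4.
  by rewrite sg2 (le_trans _ pq4) // ler_piMl //; have /andP[] := mV n; lra.
(* A row in the part [c] has variance [p (1 - p) (1 - nu c)], against [p (1 - p) (1 - m^-1)] for
   [sg^2]. *)
have rows n : (0 < n)%N -> forall i,
    `|\sum_k variance_profile (K n) p i k - sg n ^+ 2| <= eta n.
  move=> n0 i; have [c ic] := part_exists (V_part n) i.
  rewrite (variance_profile_row (V_part n) p n0 ic) sg2.
  rewrite (_ : _ - _ = - (p * (1 - p) * (part_ratio R (V n) c - (m n)%:R^-1))); last by ring.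
  rewrite normrN normrM ger0_norm //.
  apply: le_trans (part_ratio_spread (V_part n) n0 (m_gt0 n) c (amin n) (bmax n)).
  by rewrite ler_piMl //; lra.
have u0 n : 0 <= u n by apply: mean_ge0 => // G _; exact: normr_ge0.
have eta_cvg : eta n @[n --> \oo] --> (0 : R).
  rewrite -[X in _ --> X](subrr 1); apply: cvgB; first exact: cvg_cst.
  exact: ratio_lim.
have r_cvg : r n @[n --> \oo] --> (0 : R).
  apply/cvgr0Pnorm_le => e e0; near=> n.
  have n0 : 0 < n%:R :> R by near: n; exact: nbhs_infty_gtr.
  rewrite ger0_norm ?invr_ge0 ?sqrtr_ge0 // -[e]invrK lef_pV2 ?posrE ?sqrtr_gt0 ?invr_gt0 //.
  rewrite -(ler_pXn2r (n := 2)) ?nnegrE ?sqrtr_ge0 ?invr_ge0 ?(ltW e0) // sqr_sqrtr ?ler0n //.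
  by near: n; exact: nbhs_infty_ger.
have u_cvg : u n @[n --> \oo] --> (0 : R).
  apply/cvgr0Pnorm_le => e e0.
  have e20 : 0 < e / 2 by rewrite divr_gt0.
  have [C C0 HC] := mean_energy_bound e20.
  have cvgC : C * (r n + eta n) @[n --> \oo] --> (0 : R).
    rewrite -[X in _ --> X](mulr0 C) -[X in C * X](addr0 0).
    by apply: cvgMr; apply: cvgD.
  move/cvgr0Pnorm_le : cvgC => /(_ _ e20) cvgC.
  near=> n; have n0 : (0 < n)%N by near: n; exact: nbhs_infty_gt.
  have small : `|C * (r n + eta n)| <= e / 2 by near: n.
  rewrite ger0_norm //.
  apply: (le_trans (HC n (m n) (V n) p (sg n) (eta n) n0 (V_part n) p01 (sg0 n) (sg_le n) (rows n n0))).
  have := le_trans (ler_norm _) small; rewrite -/(r n); lra.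
(* The square root shares [u n] between threshold and failure probability: Markov's bound
   [u n / delta n] is at most [sqrt (u n)]. The harmonic term keeps [delta n] positive when [u n]
   vanishes. *)
pose delta n := Num.sqrt (u n) + harmonic n.
have sqrtu_cvg : Num.sqrt (u n) @[n --> \oo] --> (0 : R).
  by rewrite -[X in _ --> X]sqrtr0; apply: continuous_cvg => //; exact: sqrt_continuous.
exists delta.
  by rewrite -[X in _ --> X](addr0 0); apply: cvgD => //; exact: cvg_harmonic.
rewrite /almost_every_multipartite.
apply: (@squeeze_cvgr _ _ _ _ (fun n => 1 - Num.sqrt (u n)) (fun=> 1)); last 2 first.
- by rewrite -[X in _ --> X](subr0 1); apply: cvgB => //; exact: cvg_cst.
- exact: cvg_cst.
near=> n; have n0 : (0 < n)%N by near: n; exact: nbhs_infty_gt.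
rewrite random_subgraph_prob_le1 // andbT.
have d0 : 0 < delta n by rewrite ltr_wpDl ?sqrtr_ge0 // invr_gt0 ltr0n.
have dev_ge0 (G : graph n) : G \subset K n -> 0 <= @dev n G by rewrite normr_ge0.
have := markov_inequality p01 dev_ge0 d0; rewrite -/(u n).
have -> : random_subgraph_prob (K n) p (fun G => dev n G <= delta n) =
  random_subgraph_prob (K n) p (fun G => `| energy R G - n%:R `^ (3 / 2) *
           (8 / (3 * pi) * Num.sqrt (((m n)%:R - 1) / (m n)%:R * (p * (1 - p)))) |
      <= n%:R `^ (3 / 2) * delta n).
  have nR : 0 < n%:R :> R by rewrite ltr0n.
  apply: eq_bigl => G; congr (_ && _); rewrite -/(sg n) powR_three_halves //.
  have q0 : 0 < Num.sqrt n%:R ^+ 3 :> R by rewrite exprn_gt0 // sqrtr_gt0.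
  rewrite -(ler_pM2l q0) -[X in X * dev n G]gtr0_norm // -normrM mulrBr /r exprVn.
  by rewrite mulVKf // gt_eqF.
move=> markov; apply: le_trans markov.
rewrite lerD2l lerN2 mulrC ler_pdivrMr // mulrDr -expr2 sqr_sqrtr // lerDl.
by rewrite mulr_ge0 ?sqrtr_ge0 // invr_ge0 ler0n.
Unshelve. all: by end_near.
Qed.
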